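(* Let $G$ be an infinite connected locally finite multigraph with cogrowth $\mathtt{cogr}(G)\ge 1$. (i) For each vertex $x$ of $G$, the limit $\lim_{n\to\infty,\ n\in S(x)} b_n(x)^{1/n}$ exists, and there is a constant $c_x$ such that $b_n(x)\le c_x\,\mathtt{cogr}(G)^n$ for all $n\ge 1$. (ii) Furthermore, if $x$ belongs to a simple cycle of length $L$, then $c_x$ in (i) can be taken with $c_x\le 2+2L\,\mathtt{cogr}(G)^{L-2}$. (iii) If $G$ is $d$-regular, then $G$ is Ramanujan (i.e. $\rho(G)=2\sqrt{d-1}/d$) if and only if for all vertices $x$ and all $n\ge1$ we have $b_n^*(x)\le 2(d-1)^{n/2}$.
   Context: Conventions. Graphs are undirected multigraphs (loops and multiple edges allowed). Each nonloop edge has two orientations; a loop has only one orientation. An oriented edge $e$ goes from its tail $e^-$ to its head $e^+$ (equal if $e$ is a loop), and $-e$ denotes its reversal, with $-e=e$ iff $e$ is a loop. The degree of a vertex $x$ is the number of oriented edges with tail $x$ (a loop counts once). A path is a sequence of oriented edges $(e_1,\dots,e_k)$ with $e_i^+=e_{i+1}^-$; it is a cycle of length $k$ starting from $e_1^-$ if $k\ge 1$ and $e_k^+=e_1^-$. A path is nonbacktracking if no edge is immediately followed by its reversal (so $e_{i+1}\ne -e_i$ for all $1\le i<k$; in particular a loop may not be immediately repeated). A simple cycle is a nonbacktracking cycle that repeats no vertex other than its starting vertex at its end; a loop is a simple cycle of length 1. $b_n(x)$ is the number of nonbacktracking cycles of length $n$ starting from $x$, and $S(x):=\{n: b_n(x)\neq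 0\}$. A nonbacktracking cycle is fully nonbacktracking if it is a loop (length 1) or its last edge is different from the reverse of its first edge; $b_n^*(x)$ is the number of fully nonbacktracking cycles of length $n$ starting from $x$. The cogrowth is $\mathtt{cogr}(G):=\limsup_{n\to\infty}b_n(o)^{1/n}$, which does not depend on the vertex $o$. The spectral radius is $\rho(G)=\limsup_{n\to\infty}p_n(o,o)^{1/n}$, where $p_n(x,y)$ is the $n$-step transition probability of simple random walk (each step uses an oriented edge chosen uniformly among those with tail at the current vertex); it does not depend on $o$. *)

(* Defs.v *)
From mathcomp Require Import all_boot all_order all_algebra.
From mathcomp Require Import finmap.
From mathcomp Require Import all_classical all_reals all_analysis.
Set Implicit Arguments.
Unset Strict Implicit.
Unset Printing Implicit Defensive.
Import Order.TTheory GRing.Theory Num.Theory.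
Import numFieldNormedType.Exports.
Local Open Scope classical_set_scope.
Local Open Scope ring_scope.

(* Undirected multigraphs, presented by their oriented edges: an undirected
   nonloop edge is a pair {e, erev e} with e != erev e, while a loop is a single
   oriented edge e = erev e. *)
Record multigraph := Multigraph {
  vertex : choiceType;
  edge : choiceType;
  etail : edge -> vertex;
  ehead : edge -> vertex;
  erev : edge -> edge;
  erevK : involutive erev;
  etail_erev : forall e, etail (erev e) = ehead e;
  erev_loop : forall e, erev e = e <-> etail e = ehead e
}.

Section Multigraph.
Variable G : multigraph.
Implicit Types (x y : vertex G) (e f : edge G) (p : seq (edge G)).

Definition out_edges x : set (edge G) := [set e | etail e = x].

Definition locally_finite := forall x, finite_set (out_edges x).

(* The cardinals below are those of finite sets when G is locally finite;
   fset_set sends infinite sets to the empty set. *)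
Definition degree x : nat := #|` fset_set (out_edges x)|%fset.

Definition regular (d : nat) := forall x, degree x = d.

Definition is_path p : bool := sorted (fun e f => ehead e == etail f) p.

Definition nonbacktracking p : bool := sorted (fun e f => f != erev e) p.

Definition is_cycle x p : bool :=
  if p is e :: q then
    [&& is_path p, etail e == x & ehead (last e q) == x]
  else false.

Definition connected_graph := forall x y, x <> y ->
  exists e q, [/\ is_path (e :: q), etail e = x & ehead (last e q) = y].

Definition nb_cycle x p : bool := is_cycle x p && nonbacktracking p.

Definition fully_nb_cycle x p : bool :=
  nb_cycle x p &&
  (if p is e :: q then (size p == 1%N) || (last e q != erev e) else false).

Definition simple_cycle y p : bool := nb_cycle y p && uniq (map (@etail G) p).

Definition on_simple_cycle x (L : nat) :=
  exists y p, [/\ simple_cycle y p, size p = L & x \in map (@etail G) p].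

Definition num_nb (n : nat) x : nat :=
  #|` fset_set [set p : seq (edge G) | nb_cycle x p /\ size p = n]|%fset.

Definition num_fnb (n : nat) x : nat :=
  #|` fset_set [set p : seq (edge G) | fully_nb_cycle x p /\ size p = n]|%fset.

Definition nb_lengths x : set nat := [set n | num_nb n x <> 0%N].

Variable R : realType.

(* Extended-real valued, since degrees may be unbounded. *)
Definition cogr x : \bar R :=
  limn_esup (fun n => (((num_nb n x)%:R : R) `^ n%:R^-1)%:E).

Fixpoint transition (n : nat) x y : R :=
  if n is m.+1 then
    \sum_(e \in out_edges x) (degree x)%:R^-1 * transition m (ehead e) y
  else (x == y)%:R.

Definition spectral_radius x : \bar R :=
  limn_esup (fun n => (transition n x x `^ n%:R^-1)%:E).

End Multigraph.

Arguments cogr {G} R x.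
Arguments transition {G} R n x y.
Arguments spectral_radius {G} R x.

Definition ramanujan (R : realType) (G : multigraph) (d : nat) (o : vertex G) :=
  spectral_radius R o = (2 * Num.sqrt (d%:R - 1) / d%:R)%:E.

(* Main.v *)
Require Import Defs.
From mathcomp Require Import all_boot all_order all_algebra.
From mathcomp Require Import finmap zify ring lra.
From mathcomp Require Import all_classical all_reals all_analysis.
Import Order.TTheory GRing.Theory Num.Theory.
Import numFieldNormedType.Exports.
Set Implicit Arguments.
Unset Strict Implicit.
Unset Printing Implicit Defensive.
Local Open Scope classical_set_scope.

(** Write [f_a(n)] for the number of closed walks of length [n] through the
oriented edge [a] in the digraph of nonbacktracking steps ([nbwalks a a n]),
[t_a(n)] for the number of nonbacktracking cycles of length [n] that leave
along [a] and come back along its reverse, and [lam] for the cogrowth.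

Closed walks at [a] concatenate, so [f_a(n) ^ k <= f_a(k n) <= b_(kn)], whence
the sharp bound [f_a(n) <= lam ^ n] ([nbwalks_le_rate]).  Cycles of length [n]
at [x] may be strung together as long as the next one does not start with the
reverse of the last edge used; at least [K = b_n(x) - m] choices are always
available, where [m] is the largest number of cycles sharing a first edge.
Therefore [K <= lam ^ n], that is, for some edge [b] at [x]
[b_n(x) <= lam ^ n + t_b(n) + f_b(n) <= 2 lam ^ n + t_b(n)]
([num_nb_le_turns]).  This yields [b*_n(x) <= 2 lam ^ n] at once
([num_fnb_le]), and reduces everything to bounding [t_b].

If [b] lies on a closed walk [c] of length [L], a cycle counted by [t_b] has
the form [T Q T^-1], with [T] the longest possible stem along [c]; replacing
[T^-1] by the continuation of [c] (or doing this to the reversed cycle) gives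
a closed walk, and [t_b(n)] is at most twice a sum of [L] values of [f_b], up
to one exceptional cycle ([turns_le]).  Conversely an exponential bound on
[f_a], for a single edge [a] on a closed walk, bounds [b_n] at every vertex
([rate_le_of_nbwalks], [rate_connected]).  Applied to [f_a(n) <= lam ^ n] this
is the upper bound in (i); its contrapositive provides, at any rate
[nu < lam], an edge with [f_a(M) > nu ^ M], and inserting powers of such closed
walks into one cycle for each residue modulo [M] proves the limit along the
lengths that occur ([num_nb_eventually_ge]).

For (ii) there are three cases.  If [lam + 1 <= lam ^ 2], the dominance
inequality and [t_b(n) <= b_(n-2)] at the other end of [b] give by induction
[b_n <= (2 + 2 / lam) lam ^ n] at every vertex.  Otherwise [lam < 2]; for
[L >= 2] the term [t_b] is bounded by inserting the simple cycle when [b] is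
not on it, and by the replacement above when it is.  For a loop [c] one
has [b_n <= f_c(n+1) + 2 f_c(n) + f_c(n-1)], and as [c] is never used twice in
a row, a renewal argument gives
[f_c(n) / lam ^ n + f_c(n+1) / lam ^ n.+1 <= 1] ([num_nb_le_loop]).

For (iii), let [nu ^ 2 = d - 1] and let [w n k] count the walks at [o] made of
[n] arbitrary steps followed by a nonbacktracking path of length [k] back to
[o].  Then [w n.+1 k = w n k.+1 + (d - 1) w n k.-1] for [k >= 2], with boundary
corrections at [k = 0, 1]; this is the radial recursion of the [d]-regular
tree.  A positive supersolution turns [w 0 k <= C nu ^ k] into
[w n 0 <= C' (2 nu) ^ n]; summing over [n] with weights [z ^ n] turns upper bounds on
[w n 0] into a three-term inequality in [k], which has no positive solution
when [w n 0] grows more slowly than [(2 nu) ^ n] and forces [w 0 k] to grow at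
rate at most [nu] when it grows no faster.  Hence a graph is Ramanujan exactly when
[lam <= nu] ([ramanujanP]); the bound on [b*_n] follows from, and by
[rate_le_of_nbwalks] implies, that inequality. *)

(** * Counting in finite sets *)

Definition cnt (T : choiceType) (A : set T) : nat := #|` fset_set A|%fset.

Section Counting.
Implicit Types T U : choiceType.

Lemma cnt_enum T (A : set T) : finite_set A ->
  exists s : seq T, [/\ uniq s, size s = cnt A & forall x, x \in s <-> A x].
Proof.
move=> fA; exists (enum_fset (fset_set A)); split=> [||x]; first exact: fset_uniq.
  by [].
have -> : (x \in enum_fset (fset_set A)) = (x \in A) by rewrite -in_fset_set.
by rewrite inE.
Qed.

Lemma leq_size_cnt T (A : set T) (s : seq T) : finite_set A -> uniq s ->
  (forall x, x \in s -> A x) -> (size s <= cnt A)%N.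
Proof.
move=> /cnt_enum[t [_ <- tA]] us sA.
by apply: uniq_leq_size => // x /sA /tA.
Qed.

Lemma leq_cnt_inj T U (f : T -> U) (A : set T) (B : set U) : finite_set B ->
  (forall x, A x -> B (f x)) ->
  (forall x y, A x -> A y -> f x = f y -> x = y) -> (cnt A <= cnt B)%N.
Proof.
move=> fB AB finj; have [fA|nfA] := pselect (finite_set A); last first.
  by rewrite /cnt /fset_set; case: pselect => // _; rewrite cardfs0.
have [s [us <- sA]] := cnt_enum fA.
rewrite -(size_map f); apply: leq_size_cnt => //.
  rewrite map_inj_in_uniq // => x y /sA Ax /sA Ay; exact: finj.
by move=> _ /mapP[x /sA Ax ->]; exact: AB.
Qed.

Lemma leq_cnt T (A B : set T) : finite_set B -> A `<=` B -> (cnt A <= cnt B)%N.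
Proof. by move=> fB AB; apply: (@leq_cnt_inj _ _ id). Qed.

Lemma leq_cntD T (A B C : set T) : finite_set C -> A `<=` C -> B `<=` C ->
  (forall x, A x -> B x -> False) -> (cnt A + cnt B <= cnt C)%N.
Proof.
move=> fC AC BC AB.
have [s [us <- sA]] := cnt_enum (sub_finite_set AC fC).
have [t [ut <- tB]] := cnt_enum (sub_finite_set BC fC).
rewrite -size_cat; apply: leq_size_cnt => // [|x].
  rewrite cat_uniq us ut andbT /=; apply/hasPn => x /tB Bx.
  by apply/negP => /sA /AB; apply.
by rewrite mem_cat => /orP[/sA/AC|/tB/BC].
Qed.

Lemma cnt_leqD T (A B C : set T) : finite_set A -> finite_set B ->
  (forall x, C x -> A x \/ B x) -> (cnt C <= cnt A + cnt B)%N.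
Proof.
move=> fA fB CAB.
have fC : finite_set C by apply: (@sub_finite_set _ _ (A `|` B)) => //; rewrite finite_setU.
have [s [us <- sA]] := cnt_enum fA; have [t [ut <- tB]] := cnt_enum fB.
have [u [uu <- uC]] := cnt_enum fC.
rewrite -size_cat; apply: uniq_leq_size => // x /uC /CAB.
by rewrite mem_cat => -[/sA ->|/tB ->] //; rewrite orbT.
Qed.

Lemma cnt_leqD4 T (A B C D E : set T) :
  finite_set A -> finite_set B -> finite_set C -> finite_set D ->
  (forall x, E x -> (A x \/ B x) \/ (C x \/ D x)) ->
  (cnt E <= cnt A + cnt B + (cnt C + cnt D))%N.
Proof.
move=> fA fB fC fD HE.
apply: leq_trans (leq_add (@cnt_leqD _ A B (A `|` B) fA fB _)
  (@cnt_leqD _ C D (C `|` D) fC fD _)) => //.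
by apply: cnt_leqD HE; rewrite finite_setU.
Qed.

Lemma cnt_set0 T (A : set T) : (forall x, ~ A x) -> cnt A = 0%N.
Proof.
by move=> A0; rewrite (_ : A = set0) ?/cnt ?fset_set0 ?cardfs0 //; apply/seteqP; split.
Qed.

Lemma cnt_leq1 T (A : set T) : (forall x y, A x -> A y -> x = y) -> (cnt A <= 1)%N.
Proof.
move=> A1; have -> : 1%N = cnt [set tt] by rewrite /cnt fset_set1 cardfs1.
by apply: (@leq_cnt_inj _ _ (fun=> tt)) => // x y Ax Ay _; exact: A1.
Qed.

Lemma cnt_gt0 T (A : set T) x : finite_set A -> A x -> (0 < cnt A)%N.
Proof.
move=> fA Ax; have /= := @leq_size_cnt _ A [:: x] fA isT; apply.
by move=> y; rewrite inE => /eqP ->.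
Qed.

Lemma cnt_gt0_ex T (A : set T) : (0 < cnt A)%N -> exists x, A x.
Proof.
rewrite lt0n => /eqP A0; apply: contrapT => nA; apply: A0; apply: cnt_set0 => x Ax.
by apply: nA; exists x.
Qed.

Lemma cnt_sum T (I : eqType) (f : T -> I) (A : set T) (s : seq I) : finite_set A ->
  uniq s -> (forall x, A x -> f x \in s) ->
  cnt A = (\sum_(i <- s) cnt [set x | A x /\ f x = i])%N.
Proof.
move=> fA us fs.
have fin (P : T -> Prop) : finite_set [set x | A x /\ P x].
  by apply: sub_finite_set fA => x [].
have -> : A = [set x | A x /\ f x \in s].
  by apply/seteqP; split => x => [Ax|[]//]; split=> //; exact: fs.
transitivity (\sum_(i <- s) cnt [set x | A x /\ f x = i])%N; last first.
  rewrite big_seq [RHS]big_seq; apply: eq_bigr => i si; congr cnt.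
  by apply/seteqP; split => x /= => [[? <-]|[[]]]; split=> //; split=> //; exact: fs.
elim: s us {fs} => [_|i s IHs /= /andP[nis us]].
  by rewrite big_nil; apply: cnt_set0 => x [].
rewrite big_cons -IHs //; apply/eqP; rewrite eqn_leq; apply/andP; split.
  apply: cnt_leqD => // x /= [Ax]; rewrite inE => /orP[/eqP|]; first by left.
  by right.
apply: leq_cntD => // x /=.
- by move=> [Ax ->]; rewrite mem_head.
- by move=> [Ax xs]; rewrite inE xs orbT.
- by move=> [_ ->] [_ xs]; rewrite xs in nis.
Qed.

Lemma leq_mul_cnt T U (f : U -> T) (A : set T) (B : set U) (K : nat) :
  finite_set A -> finite_set B ->
  (forall x, A x -> (K <= cnt [set y | B y /\ f y = x])%N) ->
  (K * cnt A <= cnt B)%N.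
Proof.
move=> fA fB AB; have [s [us <- sA]] := cnt_enum fA.
have -> : (K * size s)%N = (\sum_(x <- s) K)%N.
  by rewrite big_const_seq count_predT iter_addn_0.
apply: leq_trans (_ : cnt [set y | B y /\ f y \in s] <= _)%N; last first.
  by apply: leq_cnt => // y [].
rewrite (@cnt_sum _ _ f _ s) //; first last.
- by move=> x [].
- by apply: sub_finite_set fB => y [].
rewrite [leqLHS]big_seq [leqRHS]big_seq; apply: leq_sum => x xs.
have /sA/AB := xs; move/leq_trans; apply.
apply: leq_cnt; first by apply: sub_finite_set fB => y [[]].
by move=> y [By fy]; split=> //; split=> //=; rewrite fy.
Qed.

End Counting.

(** * Nonbacktracking walks *)

Section NonBacktracking.
Variable G : multigraph.
Implicit Types (x y : vertex G) (a b c e f : edge G) (p q w : seq (edge G)).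

(** Nonbacktracking paths are the walks of the digraph [step] on oriented edges.
Counting walks of this digraph between two edges, rather than paths between
two vertices, makes concatenation free of side conditions.  The walk [w] lists
the edges after [a], so that its length is the number of steps. *)
Definition step e f := (ehead e == etail f) && (f != erev e).

Definition nbwalk a b n : set (seq (edge G)) :=
  [set w | [/\ size w = n, path step a w & last a w = b]].

Definition nbwalks a b n := cnt (nbwalk a b n).

Definition nbcycle x n : set (seq (edge G)) :=
  [set p | nb_cycle x p /\ size p = n].

Definition reversal p := rev (map (@erev G) p).

Lemma num_nbE n x : num_nb n x = cnt (nbcycle x n).
Proof. by []. Qed.

Lemma ehead_erev e : ehead (erev e) = etail e.
Proof. by rewrite -(etail_erev (erev e)) erevK. Qed.

Lemma erev_inj : injective (@erev G).
Proof. exact: inv_inj (@erevK G). Qed.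

Lemma step_rev e f : step (erev f) (erev e) = step e f.
Proof.
by rewrite /step ehead_erev etail_erev erevK (eq_sym (etail f)) (eq_sym (erev e)).
Qed.

Lemma stepNN e : step e (erev e) = false.
Proof. by rewrite /step eqxx andbF. Qed.

Lemma nb_cycleE x p : nb_cycle x p =
  if p is a :: q then [&& path step a q, etail a == x & ehead (last a q) == x]
  else false.
Proof.
case: p => [|a q] //; rewrite /nb_cycle /is_cycle /is_path /nonbacktracking /=.
have -> : path step a q = path (fun e f => ehead e == etail f) a q &&
    path (fun e f => f != erev e) a q.
  by rewrite -(path_relI (fun e f => ehead e == etail f)).
by case: path; case: path; rewrite /= ?andbT ?andbF.
Qed.

Lemma nbcycle_cons x n p : nbcycle x n p -> exists a q,
  [/\ p = a :: q, n = (size q).+1, path step a q, etail a = x & ehead (last a q) = x].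
Proof.
case; rewrite nb_cycleE; case: p => [//|a q] /and3P[pq /eqP tx /eqP hx] <-.
by exists a, q.
Qed.

Lemma nbcycle_consP x n a q : nbcycle x n (a :: q) <->
  [/\ n = (size q).+1, path step a q, etail a = x & ehead (last a q) = x].
Proof.
split; first by case/nbcycle_cons=> a' [q' [[<- <-]]].
by case=> -> pq ta ha; split=> //; rewrite nb_cycleE pq ta ha !eqxx.
Qed.

Lemma size_reversal p : size (reversal p) = size p.
Proof. by rewrite size_rev size_map. Qed.

Lemma reversalK : involutive reversal.
Proof.
move=> p; rewrite /reversal map_rev revK -map_comp -[RHS]map_id.
by apply: eq_map => e /=; rewrite erevK.
Qed.

Lemma reversal_cons a q : reversal (a :: q) = rcons (reversal q) (erev a).
Proof. by rewrite /reversal /= rev_cons. Qed.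

Lemma reversal_rcons q a : reversal (rcons q a) = erev a :: reversal q.
Proof. by rewrite /reversal map_rcons rev_rcons. Qed.

Lemma sorted_reversal p : sorted step (reversal p) = sorted step p.
Proof.
rewrite /reversal rev_sorted sorted_map; case: p => //= a q.
by apply: eq_path => e f /=; rewrite step_rev.
Qed.

Lemma nth_reversal a p i : (i < size p)%N ->
  nth a (reversal p) i = erev (nth a p (size p - i.+1)).
Proof.
move=> ip; rewrite nth_rev ?size_map // (nth_map a) //; lia.
Qed.

Lemma nbcycle_reversal x n p : nbcycle x n p -> nbcycle x n (reversal p).
Proof.
move=> /[dup] /nbcycle_cons[a [q [-> _ pq ta ha]]] [_ sp]; split; last by rewrite size_reversal.
have := sorted_reversal (a :: q); rewrite lastI reversal_rcons /= nb_cycleE -lastI /=.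
move=> ->; rewrite pq etail_erev ha eqxx /=.
have : last (erev a) (reversal (a :: q)) = erev a by rewrite reversal_cons last_rcons.
by rewrite lastI reversal_rcons /= => ->; rewrite ehead_erev ta.
Qed.

Section LocallyFinite.
Hypothesis lfG : locally_finite G.

Lemma finite_paths a n : finite_set [set w | path step a w /\ size w = n].
Proof.
elim: n a => [|n IHn] a.
  by apply: sub_finite_set (finite_set1 [::]) => w [_ /size0nil].
apply: sub_finite_set (_ : finite_set (\bigcup_(f in out_edges (ehead a))
   (cons f @` [set w | path step f w /\ size w = n]))).
  case=> [|f w] [] //= /andP[/andP[/eqP af _] fw] [sw]; exists f => //=.
  by exists w.
by apply: bigcup_finite => // f _; apply: finite_image.
Qed.

Lemma finite_nbwalk a b n : finite_set (nbwalk a b n).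
Proof. by apply: sub_finite_set (finite_paths a n) => w []. Qed.

Lemma finite_nbcycle x n : finite_set (nbcycle x n).
Proof.
case: n => [|n].
  by apply: sub_finite_set (finite_set1 [::]) => w [_ /size0nil].
apply: sub_finite_set (_ : finite_set (\bigcup_(f in out_edges x)
   (cons f @` [set w | path step f w /\ size w = n]))).
  move=> p /nbcycle_cons[a [q [-> [->] pq ta ha]]]; exists a => //.
  by exists q.
by apply: bigcup_finite => // f _; apply: finite_image; exact: finite_paths.
Qed.

(** Remembering the edge met at time [m] makes the images of different
concatenations disjoint, which the renewal argument for loops uses. *)
Lemma nbwalks_cat_at a b c m n : (nbwalks a b m * nbwalks b c n <=
  cnt [set w | nbwalk a c (m + n) w /\ nth a (a :: w) m = b])%N.
Proof.
have fin : finite_set [set w | nbwalk a c (m + n) w /\ nth a (a :: w) m = b].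
  by apply: sub_finite_set (finite_nbwalk a c (m + n)) => w [].
rewrite mulnC; apply: (@leq_mul_cnt _ _ (take m)) => //; first exact: finite_nbwalk.
move=> w [sw pw lw]; apply: (@leq_cnt_inj _ _ (cat w)).
- by apply: sub_finite_set fin => v [].
- move=> v [sv pv lv]; split; last by rewrite take_cat sw ltnn subnn take0 cats0.
  split; first by split; rewrite ?size_cat ?cat_path ?last_cat ?sw ?sv ?pw ?lw.
  by rewrite -cat_cons nth_cat /= sw ltnSn -lw -sw; have /= := nth_last a (a :: w).
- by move=> u v _ _ /eqP; rewrite eqseq_cat // eqxx => /eqP.
Qed.

Lemma nbwalks_cat a b c m n :
  (nbwalks a b m * nbwalks b c n <= nbwalks a c (m + n))%N.
Proof.
apply: leq_trans (nbwalks_cat_at _ _ _ _ _) _.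
by apply: leq_cnt => [|w []]; first exact: finite_nbwalk.
Qed.

Lemma nbwalks0 a : nbwalks a a 0 = 1%N.
Proof.
apply/eqP; rewrite eqn_leq; apply/andP; split.
  by apply: cnt_leq1 => v w [/size0nil -> _ _] [/size0nil -> _ _].
by apply: (@cnt_gt0 _ _ [::]); [exact: finite_nbwalk|split].
Qed.

Lemma nbwalks_exp a n k : (nbwalks a a n ^ k <= nbwalks a a (k * n))%N.
Proof.
elim: k => [|k IHk]; first by rewrite expn0 mul0n nbwalks0.
rewrite expnS mulSn; apply: leq_trans (nbwalks_cat a a a n (k * n)).
by rewrite leq_mul2l IHk orbT.
Qed.

(** A closed walk lists its base edge last; moving it to the front gives a cycle. *)
Lemma nbwalks_nbcycle a n : (0 < n)%N -> (nbwalks a a n <= num_nb n (etail a))%N.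
Proof.
move=> n0; rewrite num_nbE; apply: (@leq_cnt_inj _ _ (belast a)).
- exact: finite_nbcycle.
- move=> w [sw pw lw]; case/lastP: w sw pw lw => [s0 _ _|w b]; first by rewrite -s0 in n0.
  rewrite size_rcons last_rcons rcons_path belast_rcons => <- /andP[pw wb] ba.
  apply/nbcycle_consP; split=> //; move: wb; rewrite /step ba => /andP[/eqP ->] //.
- move=> v w [sv _ lv] [sw _ lw] vw.
  by have [] : a :: v = a :: w by rewrite !lastI vw lv lw.
Qed.

End LocallyFinite.
End NonBacktracking.
Arguments step {G} e f.
Arguments reversal {G} p.

(** * Turning back along a closed walk *)

(** The sequence [c] runs periodically around a closed walk of length [L] with
first edge [a].  A cycle [a :: q] that ends with the reverse of [a] is written
[T Q T^-1], where the stem [T], of length [depth q], is the longest one that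
follows [c].  If [Q] does not end with the reverse of the next edge of [c],
then after [T Q] one may go on along [c] until a multiple of [L] edges of [c]
have been used, which produces a closed walk at [a]. *)
Section Turning.
Variable G : multigraph.
Hypothesis lfG : locally_finite G.
Variables (c : nat -> edge G) (L : nat).
Hypothesis L_gt0 : (0 < L)%N.
Hypothesis c_step : forall i, step (c i) (c i.+1).
Hypothesis c_per : forall i, c (i + L)%N = c i.
Variable m : nat.
Implicit Types (q : seq (edge G)) (i j t : nat).

Local Notation a := (c 0).
Local Notation turn := (nbwalk a (erev a) m).

Lemma c_periodic i k : c (i + k * L)%N = c i.
Proof. by elim: k => [|k IHk]; rewrite ?mul0n ?addn0 // mulSn (addnC L) addnA c_per. Qed.

Definition matched q i :=
  (nth a (a :: q) i == c i) && (nth a (a :: q) (m - i) == erev (c i)).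

Definition depth q := find (fun i => ~~ matched q i) (iota 0 m.+1).

Definition deviates q := [exists i : 'I_m.+1, (i.*2 <= m)%N && ~~ matched q i].

Lemma matched0 q : turn q -> matched q 0.
Proof.
case=> sq pq lq; rewrite /matched /= eqxx subn0 -sq.
by have /= -> := nth_last a (a :: q); rewrite lq.
Qed.

Lemma depthP q : turn q -> deviates q ->
  [/\ (0 < depth q)%N, ((depth q).*2 <= m)%N, ~~ matched q (depth q) &
    forall i, (i < depth q)%N -> matched q i].
Proof.
move=> tq /existsP[k /andP[km nk]].
have hasd : has (fun i => ~~ matched q i) (iota 0 m.+1).
  by apply/hasP; exists (val k) => //; rewrite mem_iota add0n leq0n ltn_ord.
have dk : (depth q <= k)%N.
  rewrite leqNgt; apply/negP => kd; have := before_find 0%N kd.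
  by rewrite nth_iota ?ltn_ord // add0n nk.
have dm : (depth q < m.+1)%N by exact: leq_ltn_trans dk (ltn_ord k).
have nd : ~~ matched q (depth q).
  by have := nth_find 0%N hasd; rewrite nth_iota.
split=> // [||i id].
- by rewrite lt0n; apply: contra nd => /eqP ->; exact: matched0.
- by apply: leq_trans km; rewrite leq_double.
- have := before_find 0%N id; rewrite nth_iota; last exact: ltn_trans id dm.
  by rewrite add0n => /negbFE.
Qed.

Lemma path_arc e t k : step e (c t) -> path step e (mkseq (fun i => c (t + i)) k).
Proof.
move=> et; apply/(pathP a) => i; rewrite size_mkseq => ik; rewrite nth_mkseq //.
case: i ik => [|i] ik /=; first by rewrite addn0.
by rewrite nth_mkseq ?addnS //; exact: ltnW.
Qed.

(** The classes on which [steer] is injective. *)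
Definition residue q := ((depth q).-1 %% L)%N.

Definition steerable q :=
  [/\ turn q, deviates q & nth a (a :: q) (m - depth q) != erev (c (depth q))].

(** With [t = depth q] and [j = residue q], the stem has [t] edges and the
continuation [t + L - 2 (j + 1)], in total a multiple of [L] because [j] is
[t - 1] modulo [L]; so the walk closes up.  This length, rather than the
shortest one that closes up, leaves only [L] values for the length of the
result; the bound must not degrade as the stem gets longer. *)
Definition steer q := take (m - depth q) q ++
  mkseq (fun i => c (depth q + i)) (depth q + L - (residue q).+1.*2).+1.

Lemma residue_lt q : (residue q < L)%N.
Proof. by rewrite ltn_mod. Qed.

Lemma residue_le q : (0 < depth q)%N -> (residue q < depth q)%N.
Proof. by move=> d0; rewrite (leq_ltn_trans (leq_mod _ _)) // ltn_predL. Qed.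

Lemma depth_residue q : (0 < depth q)%N ->
  depth q = ((depth q).-1 %/ L * L + residue q).+1.
Proof. by move=> d0; rewrite -divn_eq prednK. Qed.

Lemma nbwalk_steer q : steerable q ->
  nbwalk a a (m.+1 + L - (residue q).+1.*2) (steer q).
Proof.
move=> [tq dq ndev]; have [d0 dm _ md] := depthP tq dq.
have [sq pq _] := tq; have rL := residue_lt q; have rd := residue_le d0.
have lastE : last a (take (m - depth q) q) = nth a (a :: q) (m - depth q).
  rewrite -nth_last size_takel ?sq; last lia.
  have [k Ek] : exists k, (m - depth q)%N = k.+1 by exists (m - depth q).-1; lia.
  by rewrite Ek /= nth_take.
have nthE i : (i < size q)%N -> step (nth a (a :: q) i) (nth a (a :: q) i.+1).
  by move=> iq /=; exact: (pathP a pq).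
split.
- rewrite size_cat size_takel ?sq ?size_mkseq; lia.
- rewrite cat_path take_path //; apply: path_arc; rewrite lastE /step.
  have -> : c (depth q) != erev (nth a (a :: q) (m - depth q)).
    by apply: contra ndev => /eqP ->; rewrite erevK.
  rewrite andbT.
  have := nthE (m - depth q)%N; rewrite sq => /(_ ltac:(lia)) /andP[/eqP -> _].
  have /md /andP[_] : ((depth q).-1 < depth q)%N by lia.
  have -> : (m - (depth q).-1 = (m - depth q).+1)%N by lia.
  move=> /eqP ->; rewrite etail_erev.
  by have /andP[/eqP -> _] := c_step (depth q).-1; rewrite prednK.
- rewrite last_cat -nth_last size_mkseq /= nth_mkseq //.
  rewrite -[RHS](c_periodic 0 (2 * ((depth q).-1 %/ L) + 1)); congr c.
  have := depth_residue d0; set k := (_ %/ _)%N; move: rd rL; nia.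
Qed.

(** The edge before the continuation is not the one that precedes it in [c],
since [q] turns back there; hence the continuation is recognized in [steer q]
as the longest final segment along [c], and [q] can be read off. *)
Lemma steer_inj q q' : steerable q -> steerable q' -> residue q = residue q' ->
  steer q = steer q' -> q = q'.
Proof.
wlog dd : q q' / (depth q <= depth q')%N.
  move=> wl; have [|/ltnW dd Sq Sq' rr ss] := leqP (depth q) (depth q'); first exact: wl.
  by symmetry; apply: wl.
move=> [tq dq ndev] [tq' dq' _] rr ss.
have [d0 dm _ md] := depthP tq dq; have [d0' dm' _ md'] := depthP tq' dq'.
have [sq pq _] := tq; have [sq' pq' _] := tq'.
have rL := residue_lt q; have rd := residue_le d0; have rd' := residue_le d0'.
have st : size (take (m - depth q) q) = (m - depth q)%N by rewrite size_takel ?sq; lia.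
have st' : size (take (m - depth q') q') = (m - depth q')%N by rewrite size_takel ?sq'; lia.
have [k Ek] : exists k, (m - depth q)%N = k.+1 by exists (m - depth q).-1; lia.
have Dk : (k < m)%N by lia.
move: dd; rewrite leq_eqVlt => /orP[/eqP ddE|dd].
  have /eqP : take (m - depth q) q = take (m - depth q') q'.
    have := congr1 (take (m - depth q)) ss; rewrite /steer take_size_cat //.
    by rewrite -ddE take_size_cat // ddE.
  rewrite -ddE => /eqP tt; apply: (@eq_from_nth _ a); first by rewrite sq sq'.
  rewrite sq => i im; have [ik|ki] := ltnP i (m - depth q).
    by rewrite -(nth_take a ik) tt nth_take.
  have id : (m - i.+1 < depth q)%N by lia.
  have /andP[_ /eqP] := md _ id; have -> : (m - (m - i.+1) = i.+1)%N by lia.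
  move=> /= ->; move: id; rewrite ddE => /md' /andP[_ /eqP].
  by have -> : (m - (m - i.+1) = i.+1)%N by lia.
(* two stems of different depths: at place [k], where the shorter one has its
   last edge of [Q], the longer one is already on its continuation along [c] *)
exfalso.
have := congr1 (fun u => nth a u k) ss.
rewrite /steer nth_cat st nth_cat st' Ek ltnSn nth_take //.
have -> : (k < m - depth q')%N = false by lia.
rewrite nth_mkseq; last by rewrite -rr; lia.
have -> : (depth q' + (k - (m - depth q')) = (depth q).-1 + 2 * (depth q' - depth q))%N by lia.
have -> : (2 * (depth q' - depth q) = 2 * ((depth q').-1 %/ L - (depth q).-1 %/ L) * L)%N.
  have := depth_residue d0; have := depth_residue d0'; rewrite -rr.
  set x := (_ %/ _)%N; set y := (_ %/ _)%N => E1 E2; by rewrite E1 E2 subSS subnDr -mulnBl mulnA.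
rewrite c_periodic => Pk.
have := pathP a pq k.+1; rewrite sq => /(_ ltac:(lia)) /=.
have /andP[_ /eqP] : matched q (depth q).-1 by apply: md; lia.
have -> : (m - (depth q).-1 = k.+2)%N by lia.
by move=> /= ->; rewrite Pk stepNN.
Qed.

Lemma cnt_steerable : (cnt [set q | steerable q] <=
  \sum_(j < L) nbwalks a a (m.+1 + L - j.+1.*2))%N.
Proof.
have fin : finite_set [set q | steerable q].
  by apply: sub_finite_set (finite_nbwalk lfG a (erev a) m) => q [].
rewrite (@cnt_sum _ _ residue _ (iota 0 L)) ?iota_uniq //; last first.
  by move=> q _; rewrite mem_iota residue_lt.
rewrite -[in X in (_ <= X)%N](big_mkord xpredT (fun j => nbwalks a a (m.+1 + L - j.+1.*2))).
rewrite /index_iota subn0; apply: leq_sum => j _.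
apply: (@leq_cnt_inj _ _ steer); first exact: finite_nbwalk.
  by move=> q /= [Sq <-]; exact: nbwalk_steer.
by move=> q q' [Sq rq] [Sq' rq']; apply: steer_inj => //; rewrite rq rq'.
Qed.

Definition backward q := behead (reversal (a :: q)).

Lemma backwardE q : turn q -> reversal (a :: q) = a :: backward q.
Proof.
move=> [_ _ lq]; rewrite /backward lastI reversal_rcons lq erevK //.
Qed.

Lemma nth_backward q i : turn q -> (i <= m)%N ->
  nth a (a :: backward q) i = erev (nth a (a :: q) (m - i)).
Proof. by move=> /[dup] /backwardE <- [sq _ _] im; rewrite nth_reversal /= sq. Qed.

Lemma turn_backward q : turn q -> turn (backward q).
Proof.
move=> tq; have [sq pq lq] := tq; split.
- by have := size_reversal (a :: q); rewrite backwardE //= => -[->].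
- by have := sorted_reversal (a :: q); rewrite backwardE //= => ->.
- have := congr1 (last a) (backwardE tq); rewrite /= => <-.
  by rewrite reversal_cons last_rcons.
Qed.

Lemma matched_backward q i : turn q -> (i <= m)%N ->
  matched (backward q) i = matched q i.
Proof.
move=> tq im; rewrite /matched !nth_backward ?leq_subr // subKn // (inj_eq (@erev_inj G)).
by rewrite andbC; congr (_ && _); rewrite (can2_eq (@erevK G) (@erevK G)).
Qed.

Lemma depth_backward q : turn q -> depth (backward q) = depth q.
Proof.
move=> tq; apply: eq_in_find => i; rewrite mem_iota add0n ltnS => /andP[_ im].
by rewrite matched_backward.
Qed.

(** By maximality of the stem, [Q] cannot both begin along [c] and end against
it, so one of the two orientations of the cycle can be continued. *)
Lemma steerable_or_backward q : turn q -> deviates q ->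
  steerable q \/ steerable (backward q).
Proof.
move=> tq dq; have [d0 dm nd _] := depthP tq dq.
have dm' : (depth q <= m)%N by lia.
have [e|ne] := eqVneq (nth a (a :: q) (m - depth q)) (erev (c (depth q))); last by left.
right; split; first exact: turn_backward.
  apply/existsP; have /existsP[i /andP[im ni]] := dq; exists i.
  by rewrite im matched_backward // -ltnS.
rewrite depth_backward // nth_backward ?leq_subr // subKn // (inj_eq (@erev_inj G)).
by apply: contra nd => /eqP E; rewrite /matched E e !eqxx.
Qed.

Lemma turns_le_deviates : (nbwalks a (erev a) m <=
  2 * \sum_(j < L) nbwalks a a (m.+1 + L - j.+1.*2) +
  cnt [set q | turn q /\ ~~ deviates q])%N.
Proof.
have fin (P : seq (edge G) -> Prop) : finite_set [set q | turn q /\ P q].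
  by apply: sub_finite_set (finite_nbwalk lfG a (erev a) m) => q [].
have finS : finite_set [set q | steerable q].
  by apply: sub_finite_set (finite_nbwalk lfG a (erev a) m) => q [].
have : (nbwalks a (erev a) m <= cnt [set q | turn q /\ deviates q] +
    cnt [set q | turn q /\ ~~ deviates q])%N.
  apply: cnt_leqD (fin _) (fin _) _ => q tq.
  by have [dq|dq] := boolP (deviates q); [left|right].
move/leq_trans; apply; rewrite leq_add2r mul2n -addnn.
apply: leq_trans (leq_add cnt_steerable cnt_steerable).
have : (cnt [set q | turn q /\ deviates q] <= cnt [set q | steerable q] +
    cnt [set q | turn q /\ steerable (backward q)])%N.
  apply: cnt_leqD finS (fin _) _ => q [tq dq].
  by have [] := steerable_or_backward tq dq; [left|right].
move/leq_trans; apply.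
rewrite leq_add2l; apply: (@leq_cnt_inj _ _ backward) => // [q []//|p q [tp _] [tq _] pq].
have E : reversal (a :: p) = reversal (a :: q) by rewrite !backwardE // pq.
by have [] := inv_inj (@reversalK G) E.
Qed.

(** The exceptional cycle is [T e T^-1] with [e] a loop on [c]: it is fixed by its
length, hence the summand 1. *)
Lemma turns_le : (nbwalks a (erev a) m <=
  2 * \sum_(j < L) nbwalks a a (m.+1 + L - j.+1.*2) + 1)%N.
Proof.
apply: leq_trans turns_le_deviates _; rewrite leq_add2l; apply: cnt_leq1.
have nthE q : turn q -> ~~ deviates q -> forall i, (i <= m)%N ->
    nth a (a :: q) i = if (i.*2 <= m)%N then c i else erev (c (m - i)).
  move=> tq /existsPn dq i im.
  have mi k : (k.*2 <= m)%N -> matched q k.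
    move=> km; have km1 : (k < m.+1)%N by lia.
    by have := dq (Ordinal km1); rewrite /= km negbK.
  case: ifP => [/mi/andP[/eqP]//|nim].
  have /mi /andP[_ /eqP] : ((m - i).*2 <= m)%N by lia.
  by rewrite subKn.
move=> p q [tp dp] [tq dq]; have [sp _ _] := tp; have [sq _ _] := tq.
apply: (@eq_from_nth _ a); rewrite ?sp ?sq // => i im.
by have := nthE _ tp dp i.+1 im; rewrite -(nthE _ tq dq i.+1 im).
Qed.

Lemma turns_le_loopless : (forall i, erev (c i) <> c i) -> (nbwalks a (erev a) m <=
  2 * \sum_(j < L) nbwalks a a (m.+1 + L - j.+1.*2))%N.
Proof.
move=> nl; apply: leq_trans turns_le_deviates _.
rewrite [X in (_ + X <= _)%N]cnt_set0 ?addn0 // => q [tq /existsPn dq].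
have [sq pq _] := tq.
have mk : ((m./2).*2 <= m)%N by lia.
have km1 : (m./2 < m.+1)%N by lia.
have := dq (Ordinal km1); rewrite /= mk negbK => /andP[/eqP E1 /eqP E2].
have := odd_double_half m; case: (odd m) => /= mE; last first.
  by apply: (nl (m./2)); rewrite -E2 -E1; congr (nth a _ _); lia.
have := pathP a pq (m./2); rewrite sq => /(_ ltac:(lia)).
move: E1 E2; have -> : (m - m./2 = (m./2).+1)%N by lia.
by move=> /= -> ->; rewrite stepNN.
Qed.

End Turning.

(** * Gluing cycles *)

Section ClosedWalks.
Variable G : multigraph.
Hypothesis lfG : locally_finite G.
Implicit Types (x y : vertex G) (a b e f z : edge G) (p q w : seq (edge G)).

Lemma nbwalk_closed a n w : (0 < n)%N -> nbwalk a a n w ->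
  exists q, [/\ w = rcons q a, n = (size q).+1, path step a q & step (last a q) a].
Proof.
case: n => // n _ [sw pw lw]; case/lastP: w sw pw lw => [//|q b].
rewrite size_rcons last_rcons rcons_path => sq /andP[pq qb] ba; exists q.
by move: qb; rewrite sq ba.
Qed.

Lemma nbwalk_rcons a q : path step a q -> step (last a q) a ->
  nbwalk a a (size q).+1 (rcons q a).
Proof. by move=> pq qa; split; rewrite ?size_rcons ?last_rcons // rcons_path pq. Qed.

Lemma stepI e f : ehead e = etail f -> f <> erev e -> step e f.
Proof. by move=> ef /eqP nf; rewrite /step ef eqxx nf. Qed.

Section Rotation.
Variables (a : edge G) (q : seq (edge G)).
Hypotheses (pq : path step a q) (qa : step (last a q) a).

Definition unroll i := nth a (a :: q) (i %% (size q).+1).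

Lemma unroll0 : unroll 0 = a. Proof. by rewrite /unroll mod0n. Qed.

Lemma unroll_periodic i : unroll (i + (size q).+1) = unroll i.
Proof. by rewrite /unroll modnDr. Qed.

Lemma unroll_step i : step (unroll i) (unroll i.+1).
Proof.
rewrite /unroll; set L := (size q).+1; have rL : (i %% L < L)%N by rewrite ltn_mod.
rewrite -addn1 -modnDml addn1; move: rL; set r := (i %% L)%N => rL.
have [rq|qr] := ltnP r (size q).
  by rewrite modn_small ?ltnS //=; exact: (pathP a pq).
have -> : r = size q by move: rL; rewrite /L; lia.
by rewrite modnn /=; have /= -> := nth_last a (a :: q).
Qed.

Lemma unroll_mem i : unroll i \in a :: q.
Proof. by apply: mem_nth; rewrite /= ltn_mod. Qed.

Lemma nbwalks_turn_le m : (nbwalks a (erev a) m <=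
  2 * \sum_(j < (size q).+1) nbwalks a a (m.+1 + (size q).+1 - j.+1.*2) + 1)%N.
Proof.
have := @turns_le _ lfG unroll (size q).+1 isT unroll_step unroll_periodic m.
by rewrite unroll0.
Qed.

Lemma nbwalks_turn_le_loopless m : (forall e, e \in a :: q -> erev e <> e) ->
  (nbwalks a (erev a) m <=
  2 * \sum_(j < (size q).+1) nbwalks a a (m.+1 + (size q).+1 - j.+1.*2))%N.
Proof.
move=> nl.
have := @turns_le_loopless _ lfG unroll (size q).+1 isT unroll_step unroll_periodic m.
by rewrite unroll0; apply => i; apply: nl; exact: unroll_mem.
Qed.

End Rotation.

Lemma nbcycle_concat x m n p a q : nbcycle x m p -> nbcycle x n (a :: q) ->
  step (last a p) a -> nbcycle x (m + n) (p ++ a :: q).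
Proof.
move=> /nbcycle_cons[b [r [-> -> pr tb hb]]] /nbcycle_consP[-> pq ta ha] /= ra.
by apply/nbcycle_consP; rewrite size_cat cat_path last_cat /= pr pq ra.
Qed.

Lemma nbwalk_through a q p x m : path step a q -> etail a = x ->
  nbcycle x m p -> step (last a q) (head a p) -> step (last a p) a ->
  nbwalk a a (m + (size q).+1) (q ++ rcons p a).
Proof.
move=> pq ta /nbcycle_cons[b [r [-> -> pr tb hb]]] /= qb ra; split.
- by rewrite size_cat /= size_rcons; lia.
- by rewrite cat_path pq /= qb rcons_path pr.
- by rewrite last_cat /= last_rcons.
Qed.

Lemma last_reversal a p : p <> [::] -> last a (reversal p) = erev (head a p).
Proof. by case: p => // b p _; rewrite reversal_cons last_rcons. Qed.

Lemma head_reversal a p : p <> [::] -> head a (reversal p) = erev (last a p).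
Proof. by case/lastP: p => // p b _; rewrite reversal_rcons last_rcons. Qed.

Lemma nbcycle_nonnil x n p : nbcycle x n p -> p <> [::].
Proof. by case/nbcycle_cons=> b [r [->]]. Qed.

Lemma nbcycle_head a x n p : nbcycle x n p -> etail (head a p) = x.
Proof. by case/nbcycle_cons=> b [r [->]]. Qed.

Lemma nbcycle_last a x n p : nbcycle x n p -> ehead (last a p) = x.
Proof. by case/nbcycle_cons=> b [r [->]]. Qed.

(** Let [z] be the reverse of the last edge of the closed walk [a :: q].  A cycle
of type (first edge, reversed last edge) can be inserted into the closed walk,
in one of its two orientations, unless this type is [(a, a)] or [(z, z)]. *)
Lemma num_nb_le_through a q m : path step a q -> step (last a q) a ->
  forall z, z = erev (last a q) ->
  (num_nb m.+1 (etail a) <= 2 * nbwalks a a (m.+1 + (size q).+1) +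
     (nbwalks a (erev a) m + nbwalks z (erev z) m))%N.
Proof.
move=> pq qa z zE; move: (qa) => /andP[/eqP hq /eqP az].
have naz : a <> z by rewrite zE.
pose T := nbcycle (etail a) m.+1.
pose A := [set p | T p /\ (head a p <> z /\ last a p <> erev a)].
pose B := [set p | T p /\ (last a p <> erev z /\ head a p <> a)].
pose C := [set p | T p /\ (head a p = a /\ last a p = erev a)].
pose D := [set p | T p /\ (head a p = z /\ last a p = erev z)].
have fin (P : seq (edge G) -> Prop) : finite_set [set p | T p /\ P p].
  by apply: sub_finite_set (finite_nbcycle lfG (etail a) m.+1) => p [].
have turnle c : (cnt [set p | T p /\ (head a p = c /\ last a p = erev c)] <=
    nbwalks c (erev c) m)%N.
  apply: (@leq_cnt_inj _ _ behead); first exact: finite_nbwalk.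
    move=> p [/nbcycle_cons[b [r [-> [sr] pr _ _]]]] /= [bc lr].
    by move: pr lr; rewrite bc => pr lr; split.
  move=> p p' [/nbcycle_cons[b [r [-> _ _ _ _]]] [/= <- _]].
  by move=> [/nbcycle_cons[b' [r' [-> _ _ _ _]]] [/= <- _]] ->.
have through p : T p -> head a p <> z -> last a p <> erev a ->
    nbwalk a a (m.+1 + (size q).+1) (q ++ rcons p a).
  move=> Tp hz la; apply: (nbwalk_through pq _ Tp) => //.
    by apply: stepI; rewrite ?hq ?(nbcycle_head a Tp) -?zE.
  apply: stepI; rewrite ?(nbcycle_last a Tp) // => E.
  by apply: la; rewrite [in RHS]E erevK.
have injrc p p' : q ++ rcons p a = q ++ rcons p' a -> p = p'.
  by move/eqP; rewrite eqseq_cat // eqxx => /eqP /rcons_inj[].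
have cA : (cnt A <= nbwalks a a (m.+1 + (size q).+1))%N.
  apply: (@leq_cnt_inj _ _ (fun p => q ++ rcons p a)) => [|p [Tp [hz la]]|p p' _ _].
  - exact: finite_nbwalk.
  - exact: through.
  - exact: injrc.
have cB : (cnt B <= nbwalks a a (m.+1 + (size q).+1))%N.
  apply: (@leq_cnt_inj _ _ (fun p => q ++ rcons (reversal p) a)) => [|p [Tp [lz ha]]|p p' _ _].
  - exact: finite_nbwalk.
  - have p0 := nbcycle_nonnil Tp.
    apply: through; first exact: nbcycle_reversal.
      by rewrite head_reversal // => E; apply: lz; rewrite -E erevK.
    by rewrite last_reversal // => /erev_inj.
  - by move=> /injrc/(inv_inj (@reversalK G)).
rewrite num_nbE mul2n -addnn.
apply: leq_trans (leq_add (leq_add cA cB) (leq_add (turnle a) (turnle z))).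
apply: (cnt_leqD4 (fin _) (fin _) (fin _) (fin _)) => p Tp; rewrite /A /B /C /D /=.
have [bz|bz] := eqVneq (head a p) z; have [la|la] := eqVneq (last a p) (erev a).
- left; right; split=> //; split; first by rewrite la => /erev_inj.
  by rewrite bz => E; apply: naz.
- have [lz|/eqP lz] := eqVneq (last a p) (erev z); first by right; right.
  by left; right; split=> //; split=> //; rewrite bz => E; apply: naz.
- have [ba|/eqP ba] := eqVneq (head a p) a; first by right; left.
  by left; right; split=> //; split=> //; rewrite la => /erev_inj.
- by left; left; split=> //; split=> //; apply/eqP.
Qed.

Lemma nbwalk_reverse a q : path step a q -> step (last a q) a ->
  let z := erev (last a q) in exists q',
  [/\ reversal (a :: q) = z :: q', size q' = size q, path step z q' & step (last z q') z].
Proof.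
move=> pq qa z; exists (reversal (belast a q)).
have E : reversal (a :: q) = z :: reversal (belast a q) by rewrite lastI reversal_rcons.
split=> //.
- by rewrite size_reversal size_belast.
- by have := sorted_reversal (a :: q); rewrite E /= pq.
- have := last_reversal a (p := a :: q); rewrite E /= => -> //.
  by rewrite step_rev.
Qed.

(** A closed walk at [z], read backwards, can be inserted after [a :: q]. *)
Lemma nbwalks_shift a q n : path step a q -> step (last a q) a ->
  forall z, z = erev (last a q) ->
  (nbwalks z z n.+1 <= nbwalks a a (n.+1 + (size q).+1))%N.
Proof.
move=> pq qa z zE; move: (qa) => /andP[/eqP hq /eqP az].
apply: (@leq_cnt_inj _ _ (fun w => q ++ rcons (reversal (belast z w)) a)).
- exact: finite_nbwalk.
- move=> w /nbwalk_closed-/(_ isT)[r [-> [nr] pr rz]]; rewrite belast_rcons nr.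
  move: (rz) => /andP[/eqP hr /eqP zr].
  have tz : etail z = etail a by rewrite zE etail_erev.
  have N : nbcycle (etail a) (size r).+1 (reversal (z :: r)).
    by apply: nbcycle_reversal; apply/nbcycle_consP; rewrite pr hr.
  apply: (nbwalk_through pq _ N) => //.
    rewrite head_reversal //; apply: stepI.
    + by rewrite hq etail_erev /= hr tz.
    + by move=> /= E; apply: zr; rewrite E.
  rewrite last_reversal //; apply: stepI => /=; first by rewrite ehead_erev.
  by rewrite erevK zE.
- move=> w w' /nbwalk_closed-/(_ isT)[r [-> _ _ _]] /nbwalk_closed-/(_ isT)[r' [-> _ _ _]].
  rewrite !belast_rcons => /eqP; rewrite eqseq_cat // eqxx => /eqP /rcons_inj[].
  by move/(inv_inj (@reversalK G)) => -[->].
Qed.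

End ClosedWalks.

(** * The dominant first edge *)

Section Dominance.
Variable G : multigraph.
Hypothesis lfG : locally_finite G.
Implicit Types (x y : vertex G) (a b e f z : edge G) (p q w : seq (edge G)).

Definition leaving b n : set (seq (edge G)) := [set q | nbcycle (etail b) n (b :: q)].

Lemma finite_leaving b n : finite_set (leaving b n).
Proof.
apply: sub_finite_set (finite_paths lfG b n.-1) => q /nbcycle_consP[-> pq _ _].
by split.
Qed.

Lemma cnt_leaving b m :
  (cnt (leaving b m.+1) <= nbwalks b (erev b) m + nbwalks b b m.+1)%N.
Proof.
have fin (P : seq (edge G) -> Prop) : finite_set [set q | leaving b m.+1 q /\ P q].
  by apply: sub_finite_set (finite_leaving b m.+1) => q [].
have := @cnt_leqD _ [set q | leaving b m.+1 q /\ last b q = erev b]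
  [set q | leaving b m.+1 q /\ last b q <> erev b] (leaving b m.+1) (fin _) (fin _).
move=> /(_ _)/leq_trans; apply=> [q Lq|].
  by have [E|/eqP E] := eqVneq (last b q) (erev b); [left|right].
apply: leq_add; first apply: leq_cnt; first exact: finite_nbwalk.
  by move=> q [/nbcycle_consP[[sq] pq _ _] lq]; split.
apply: (@leq_cnt_inj _ _ (fun q => rcons q b)) => [|q|q q' _ _ /rcons_inj[]//].
  exact: finite_nbwalk.
move=> [/nbcycle_consP[[sq] pq _ hq] lq]; rewrite sq; apply: nbwalk_rcons => //.
by apply: stepI => // E; apply: lq; rewrite [in RHS]E erevK.
Qed.

Lemma num_nb_iterate x n K :
  (forall b, etail b = x -> (K + cnt (leaving b n) <= num_nb n x)%N) ->
  forall k, (K ^ k * num_nb n x <= num_nb (k.+1 * n) x)%N.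
Proof.
move=> HK; elim=> [|k IHk]; first by rewrite expn0 !mul1n.
rewrite expnS -mulnA; apply: leq_trans (_ : K * num_nb (k.+1 * n) x <= _)%N.
  by rewrite leq_mul2l IHk orbT.
rewrite !num_nbE; apply: (@leq_mul_cnt _ _ (take (k.+1 * n))); try exact: finite_nbcycle.
move=> p Tp; have [_ sp] := Tp; have [a [r [pE _ pr ta ha]]] := nbcycle_cons Tp.
have tb : etail (erev (last a p)) = x by rewrite pE etail_erev.
have := HK _ tb; rewrite num_nbE => HK'.
rewrite -(leq_add2r (cnt (leaving (erev (last a p)) n))); apply: leq_trans HK' _.
pose A := [set q | nbcycle x n q /\ head a q <> erev (last a p)].
pose B := [set q | nbcycle x n q /\ head a q = erev (last a p)].
have fin (P : seq (edge G) -> Prop) : finite_set [set q | nbcycle x n q /\ P q].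
  by apply: sub_finite_set (finite_nbcycle lfG x n) => q [].
apply: leq_trans (_ : cnt A + cnt B <= _)%N; last first.
  apply: leq_add.
    apply: (@leq_cnt_inj _ _ (cat p)) => [|q [Tq hq]|q q' _ _ /eqP].
    - by apply: sub_finite_set (finite_nbcycle lfG x (k.+2 * n)) => q [].
    - split; last by rewrite take_size_cat.
      rewrite mulSn addnC; have [b [s [qE _ _ _ _]]] := nbcycle_cons Tq.
      rewrite qE in Tq hq *; apply: (nbcycle_concat (a := b) Tp Tq).
      have lab : last b p = last a p by rewrite pE.
      rewrite lab; apply: stepI => //; rewrite (nbcycle_last a Tp).
      by rewrite -(nbcycle_head a Tq).
    - by rewrite eqseq_cat // eqxx => /eqP.
  apply: (@leq_cnt_inj _ _ behead) => [|q [Tq hq]|q q' [Tq hq] [Tq' hq']].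
  - exact: finite_leaving.
  - have [b [s [qE _ _ _ _]]] := nbcycle_cons Tq; rewrite qE in Tq hq *.
    by rewrite /leaving /= tb -hq.
  - have [b [s [qE _ _ _ _]]] := nbcycle_cons Tq; have [b' [s' [qE' _ _ _ _]]] := nbcycle_cons Tq'.
    by move: hq hq'; rewrite qE qE' /= => -> -> ->.
apply: cnt_leqD (fin _) (fin _) _ => q Tq.
by have [E|/eqP E] := eqVneq (head a q) (erev (last a p)); [right|left].
Qed.

(** Taking for [b] the first edge shared by the most cycles, every cycle has at
least [num_nb m.+1 x - cnt (leaving b m.+1)] continuations. *)
Lemma num_nb_dominant x m : (0 < num_nb m.+1 x)%N -> exists b, etail b = x /\
  forall k, ((num_nb m.+1 x - (nbwalks b (erev b) m + nbwalks b b m.+1)) ^ k * num_nb m.+1 x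
    <= num_nb (k.+1 * m.+1) x)%N.
Proof.
move=> nb0.
pose P k := `[< exists2 b, etail b = x & cnt (leaving b m.+1) = k >].
have Lle b : etail b = x -> (cnt (leaving b m.+1) <= num_nb m.+1 x)%N.
  move=> tb; rewrite num_nbE; apply: (@leq_cnt_inj _ _ (cons b)).
  - exact: finite_nbcycle.
  - by move=> q; rewrite /leaving /= tb.
  - by move=> q q' _ _ [].
have exP : exists k, P k.
  have [p /nbcycle_cons[b [r [_ _ _ tb _]]]] := cnt_gt0_ex nb0.
  by exists (cnt (leaving b m.+1)); apply/asboolP; exists b.
have ubP k : P k -> (k <= num_nb m.+1 x)%N by move=> /asboolP[b /Lle tb <-].
have [h /asboolP[b tb hb] hmax] := ex_maxnP exP ubP; exists b; split=> // k.
apply: leq_trans (num_nb_iterate (K := num_nb m.+1 x - h) _ k).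
  rewrite leq_mul2r; case: k => [|k]; first by rewrite !expn0 leqnn orbT.
  by rewrite leq_exp2r // leq_sub2l ?orbT // -hb; exact: cnt_leaving.
move=> b' tb'; have Hb := Lle _ tb; rewrite hb in Hb.
have : (cnt (leaving b' m.+1) <= h)%N by apply: hmax; apply/asboolP; exists b'.
by move=> Hb'; rewrite -{2}(subnK Hb) leq_add2l.
Qed.

End Dominance.

(** * Changing the base vertex *)

Section Neighbour.
Variable G : multigraph.
Hypothesis lfG : locally_finite G.
Implicit Types (x y : vertex G) (a b c d e f g z : edge G) (p q w : seq (edge G)).

Lemma num_nb0 x : num_nb 0 x = 0%N.
Proof. by rewrite num_nbE cnt_set0 // => p /nbcycle_cons[a [q []]]. Qed.

(** Conjugating by [g] and reducing moves a cycle at the tail of [g] to its head;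
the length changes by [2], [0] or [-2] according to cancellation at the ends. *)
Lemma num_nb_neighbour g n : etail g <> ehead g ->
  (num_nb n (etail g) <= num_nb n.+2 (ehead g) + num_nb n (ehead g) +
     (num_nb n (ehead g) + num_nb (n - 2) (ehead g)))%N.
Proof.
move=> nlg; set x := etail g; set y := ehead g.
pose T := nbcycle x n.
pose A := [set p | T p /\ (head g p <> g /\ last g p <> erev g)].
pose B := [set p | T p /\ (head g p = g /\ last g p <> erev g)].
pose C := [set p | T p /\ (head g p <> g /\ last g p = erev g)].
pose D := [set p | T p /\ (head g p = g /\ last g p = erev g)].
have fin (P : seq (edge G) -> Prop) : finite_set [set p | T p /\ P p].
  by apply: sub_finite_set (finite_nbcycle lfG x n) => p [].
have cA : (cnt A <= num_nb n.+2 y)%N.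
  apply: (@leq_cnt_inj _ _ (fun p => erev g :: rcons p g)); first exact: finite_nbcycle.
    move=> p [Tp [hg lg]]; have := nbcycle_last g Tp.
    have [b [r [pE nE pr tb hb]]] := nbcycle_cons Tp; rewrite pE in hg lg * => /= hl.
    apply/nbcycle_consP; rewrite /= size_rcons last_rcons etail_erev nE; split=> //.
    rewrite rcons_path pr /=; apply/andP; split.
      by apply: stepI; rewrite ?ehead_erev ?erevK.
    by apply: stepI => // E; apply: lg; rewrite /= [in RHS]E erevK.
  by move=> p p' _ _ [/rcons_inj[]].
have turn p : T p -> head g p = g -> last g p <> erev g ->
    nbcycle y n (rcons (behead p) g).
  move=> Tp; have [b [r [pE nE pr tb hb]]] := nbcycle_cons Tp; rewrite {}pE /= => bg lg.
  rewrite {}bg in pr tb hb lg; case: r nE pr hb lg => [|c r] nE pr hb lg.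
    by case: nlg; move: hb => /= ->; rewrite -/x.
  move: pr => /= /andP[gc cr]; apply/nbcycle_consP; rewrite size_rcons last_rcons.
  split=> //; last by move: gc => /andP[/eqP].
  rewrite rcons_path cr; apply: stepI; first by rewrite hb.
  by move=> E; apply: lg; rewrite /= [in RHS]E erevK.
have cB : (cnt B <= num_nb n y)%N.
  apply: (@leq_cnt_inj _ _ (fun p => rcons (behead p) g)); first exact: finite_nbcycle.
    by move=> p [Tp [hg lg]]; exact: turn.
  move=> p p' [Tp [hg _]] [Tp' [hg' _]] /rcons_inj[].
  case: p p' Tp Tp' hg hg' => [|b p] [|b' p'] /= Tp Tp'; try by case/nbcycle_nonnil: Tp.
    by case/nbcycle_nonnil: Tp'.
  by move=> -> -> ->.
have cC : (cnt C <= num_nb n y)%N.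
  apply: leq_trans cB; apply: (@leq_cnt_inj _ _ reversal); first exact: fin.
    move=> p [Tp [hg lg]]; have p0 := nbcycle_nonnil Tp.
    split; first exact: nbcycle_reversal.
    by rewrite head_reversal // last_reversal // lg erevK; split=> // /erev_inj.
  by move=> p p' _ _ /(inv_inj (@reversalK G)).
have cD : (cnt D <= num_nb (n - 2) y)%N.
  apply: (@leq_cnt_inj _ _ (fun p => behead (belast g (behead p)))); first exact: finite_nbcycle.
    move=> p [Tp []]; have [b [r [pE nE pr tb hb]]] := nbcycle_cons Tp; rewrite {}pE /= => bg.
    rewrite {}bg in pr tb hb *; case: r nE pr hb => [|c r] nE pr hb lg.
      by case: nlg; move: hb => /= ->; rewrite -/x.
    move: pr; case/lastP: r nE hb lg => [|r d] nE hb /= lg.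
      by rewrite lg stepNN.
    move: lg; rewrite last_rcons => ->; rewrite rcons_path => /and3P[gc cr rg].
    rewrite /= belast_rcons; apply/nbcycle_consP; rewrite nE /= size_rcons; split=> //.
    - by move: gc => /andP[/eqP].
    - by move: rg => /andP[/eqP ->]; rewrite etail_erev.
  move=> p p' [Tp [hg lg]] [Tp' [hg' lg']].
  have [b [r [pE nE pr tb hb]]] := nbcycle_cons Tp.
  have [b' [r' [pE' nE' pr' tb' hb']]] := nbcycle_cons Tp'.
  rewrite {}pE {}pE' /= in hg lg hg' lg' *; rewrite {}hg {}hg' in lg lg' *.
  case: r nE lg {pr hb} => [|c r] nE lg; case: r' nE' lg' {pr' hb'} => [|c' r'] nE' lg' //=.
  - by move: nE'; rewrite nE.
  - by move: nE'; rewrite nE.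
  - by move=> E; congr (_ :: _); rewrite lastI [RHS]lastI E; move: lg lg' => /= -> ->.
rewrite num_nbE; apply: leq_trans (leq_add (leq_add cA cB) (leq_add cC cD)).
apply: (cnt_leqD4 (fin _) (fin _) (fin _) (fin _)) => p Tp; rewrite /A /B /C /D /=.
have [bz|/eqP bz] := eqVneq (head g p) g; have [la|/eqP la] := eqVneq (last g p) (erev g); by tauto.
Qed.

End Neighbour.

(** * Recurrent and transient edges *)

Section Recurrence.
Variable G : multigraph.
Hypothesis lfG : locally_finite G.
Implicit Types (x y : vertex G) (a b c e f g z : edge G) (p q w : seq (edge G)).

(** [a] lies on a closed walk of the digraph [step]; equivalently, it is the first
edge of a fully nonbacktracking cycle of length at least 2. *)
Definition recurrent a := exists q, path step a q /\ step (last a q) a.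

Lemma recurrent_nbcycle x n a q : nbcycle x n (a :: q) -> last a q <> erev a -> recurrent a.
Proof.
move=> /nbcycle_consP[_ pq ta ha] la; exists q; split=> //.
by apply: stepI; rewrite ?ha // => E; apply: la; rewrite [in RHS]E erevK.
Qed.

(** Combining a cycle that leaves and returns along [a] with one that does not
would make [a] recurrent; so when [a] is transient, all cycles at its tail must
pass through it both ways. *)
Lemma transient_turns x m n a r p : ~ recurrent a -> nbcycle x m (a :: r) ->
  nbcycle x n p -> head a p = a /\ last a p = erev a.
Proof.
move=> nra Tr Tp.
have lr : last a r = erev a.
  by apply: contrapT => lr; apply: nra; exact: recurrent_nbcycle Tr lr.
have key p' k : nbcycle x k p' -> last a p' <> erev a -> head a p' = a \/ head a p' <> a -> False.
  move=> T' la' [] ha'; apply: nra.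
    have [b [s [pE _ _ _ _]]] := nbcycle_cons T'; rewrite pE /= in T' la' ha' *.
    by rewrite ha' in T' la'; exact: recurrent_nbcycle T' la'.
  have [b [s [pE _ _ tb _]]] := nbcycle_cons T'; rewrite pE /= in T' la' ha' *.
  have lb : last b (a :: r) = erev a by [].
  have := nbcycle_concat (p := a :: r) Tr T'; rewrite lb => /(_ _)/recurrent_nbcycle.
  rewrite last_cat /=; apply=> //.
  by apply: stepI; rewrite ?ehead_erev ?erevK // tb (nbcycle_head a Tr).
have la : last a p = erev a.
  by apply: contrapT => la; apply: key Tp la _; exact: EM.
split=> //; apply: contrapT => ha.
have Tp' := nbcycle_reversal Tp; apply: key Tp' _ _; last by exact: EM.
by rewrite (last_reversal a (nbcycle_nonnil Tp)) => /erev_inj.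
Qed.

Lemma turn_strip x n p a : nbcycle x n p -> head a p = a -> last a p = erev a ->
  (1 < n)%N -> exists q, p = a :: rcons q (erev a) /\ nbcycle (ehead a) (n - 2) q.
Proof.
move=> /nbcycle_cons[b [r [-> -> pr tb hb]]] /= ba; rewrite {}ba in pr tb hb *.
case/lastP: r pr hb => [//|r d] pr hb; rewrite last_rcons => dE n1; rewrite {}dE in pr hb *.
case: r pr hb {n1} => [|c r]; first by rewrite /= stepNN.
rewrite /= rcons_path => /and3P[gc cr rg] _.
exists (c :: r); split=> //; apply/nbcycle_consP; rewrite size_rcons; split=> //.
  by move: gc => /andP[/eqP].
by move: rg => /andP[/eqP ->]; rewrite etail_erev.
Qed.

Lemma transient_loop x n p a r m : ~ recurrent a -> nbcycle x m (a :: r) ->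
  nbcycle x n p -> etail a = ehead a -> (n <= 1)%N.
Proof.
move=> nra Ta Tp la; have [hp lp] := transient_turns nra Ta Tp.
rewrite leqNgt; apply/negP => n1; have [q [pE Tq]] := turn_strip Tp hp lp n1.
have tx : etail a = x by have := nbcycle_head a Ta.
rewrite -la tx in Tq; have [hq _] := transient_turns nra Ta Tq.
have [c [s [qE _ _ _ _]]] := nbcycle_cons Tq.
rewrite pE qE in Tp; rewrite qE /= in hq; rewrite {}hq in Tp.
have [_ /(_ la) Ea] := erev_loop a.
by case/nbcycle_consP: Tp => _ /= /andP[]; rewrite /step Ea eqxx andbF.
Qed.

Lemma transient_nonloop x n p a : nbcycle x n p -> head a p = a ->
  etail a <> ehead a -> last a p = erev a -> (1 < n)%N.
Proof.
move=> /nbcycle_cons[b [[|c r] [-> -> pr tb hb]]] //= ba; move: hb => /= hb.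
by rewrite -ba tb hb.
Qed.

(** All cycles at [x] run along [a] first and last.  A cycle at the head of [a]
that used the reverse of [a] as first or last edge would, after rotation or removal
of that edge, be a cycle at [x] beginning with another edge. *)
Lemma num_nb_transient x m a r n : ~ recurrent a -> nbcycle x m (a :: r) ->
  etail a <> ehead a -> (num_nb (n - 2) (ehead a) <= num_nb n x)%N.
Proof.
move=> nra Ta nla; have tx : etail a = x by have := nbcycle_head a Ta.
have [n2|n2] := leqP n 1.
  by rewrite (_ : n - 2 = 0)%N ?num_nb0 //; lia.
have head_neq q k : nbcycle (ehead a) k q -> head a q <> erev a.
  move=> Tq; have [b [s [qE kE ps tb hb]]] := nbcycle_cons Tq; rewrite {}qE /= => bE.
  rewrite {}bE in ps hb *; case: s ps hb {kE} => [|c s] /=.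
    by move=> _ hb; apply: nla; rewrite -hb ehead_erev.
  move=> /andP[ac cs] hd.
  have ca : c <> a by move: ac => /andP[_ /eqP]; rewrite erevK.
  have tc : etail c = x by move: ac => /andP[/eqP <- _]; rewrite ehead_erev.
  have [da|/eqP da] := eqVneq (last c s) a.
    case/lastP: s cs hd da => [|s d]; first by move=> _ _ /=.
    rewrite rcons_path last_rcons => /andP[cs sd] _ da; rewrite {}da in sd.
    apply: ca; have [|//] := transient_turns (p := c :: s) (n := (size s).+1) nra Ta _.
    by apply/nbcycle_consP; split=> //; move: sd => /andP[/eqP ->].
  apply: ca; have [|//] := transient_turns (p := c :: rcons s (erev a)) (n := (size s).+2) nra Ta _.
  apply/nbcycle_consP; rewrite size_rcons last_rcons ehead_erev; split=> //.
  rewrite rcons_path cs; apply: stepI; first by rewrite hd etail_erev.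
  by move=> /erev_inj E; apply: da.
have last_neq q k : nbcycle (ehead a) k q -> last a q <> a.
  move=> Tq E; apply: (head_neq _ _ (nbcycle_reversal Tq)).
  by rewrite (head_reversal a (nbcycle_nonnil Tq)) E.
rewrite !num_nbE; apply: (@leq_cnt_inj _ _ (fun q => a :: rcons q (erev a))).
- exact: finite_nbcycle.
- move=> q Tq; have hq := head_neq _ _ Tq; have lq := last_neq _ _ Tq.
  have [c [s [qE nE cs tc hs]]] := nbcycle_cons Tq; rewrite {}qE /= in hq lq *.
  apply/nbcycle_consP; rewrite /= size_rcons last_rcons ehead_erev; split=> //; first lia.
  rewrite rcons_path cs /=; apply/andP; split; apply: stepI => //.
    by rewrite hs etail_erev.
  by move=> /erev_inj E; apply: lq.
- by move=> q q' _ _ [] /rcons_inj[].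
Qed.

(** While the shortest cycle at [x] has the form [a Q a^-1] with [a] transient,
moving along [a] shortens it; this stops because one can neither turn back
within two steps nor, at a transient loop, have cycles of length at least 2. *)
Lemma exists_recurrent s x : (0 < num_nb s x)%N ->
  (forall N, exists2 n, (N <= n)%N & (0 < num_nb n x)%N) -> exists a, recurrent a.
Proof.
elim/ltn_ind: s x => s IHs x; rewrite num_nbE => /cnt_gt0_ex[p Tp] inf.
have [a [r [pE sE pr ta hr]]] := nbcycle_cons Tp; rewrite {}pE in Tp.
have [ra|nra] := pselect (recurrent a); first by exists a.
have long n q : nbcycle x n q -> (1 < n)%N ->
    etail a <> ehead a /\ exists q', nbcycle (ehead a) (n - 2) q'.
  move=> Tq n1; split=> [la|].
    by have := transient_loop nra Tp Tq la; rewrite leqNgt n1.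
  have [hq lq] := transient_turns nra Tp Tq.
  by have [q' [_ Tq']] := turn_strip Tq hq lq n1; exists q'.
have [n n2 /cnt_gt0_ex[q Tq]] := inf 2%N.
have [nla _] := long _ _ Tq n2.
have [_ la] := transient_turns nra Tp Tp.
have s1 := transient_nonloop Tp erefl nla la.
have [_ [q' Tq']] := long _ _ Tp s1.
apply: (IHs (s - 2)%N _ (ehead a)); first lia.
  by apply: cnt_gt0 Tq'; exact: finite_nbcycle.
move=> N; have [k Nk /cnt_gt0_ex[t Tt]] := inf N.+2.
exists (k - 2)%N; first lia.
have [_ [t' Tt']] := long _ _ Tt (leq_trans (isT : (1 < N.+2)%N) Nk).
by apply: cnt_gt0 Tt'; exact: finite_nbcycle.
Qed.

Lemma nbwalks_insert x n a q N : nbcycle x n (a :: q) ->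
  (nbwalks a a N <= num_nb (N + n) x)%N.
Proof.
move=> /nbcycle_consP[-> pq ta hq]; rewrite num_nbE.
apply: (@leq_cnt_inj _ _ (fun w => a :: (w ++ q))).
- exact: finite_nbcycle.
- move=> w [sw pw lw]; apply/nbcycle_consP.
  by rewrite size_cat sw addnS cat_path pw lw last_cat lw.
- move=> w w' [sw _ _] [sw' _ _] [] /eqP.
  by rewrite eqseq_cat ?sw ?sw' // => /andP[/eqP].
Qed.

End Recurrence.

(** * Reducing arbitrary walks to nonbacktracking ones *)

Section WalkDecomposition.
Variable G : multigraph.
Hypothesis lfG : locally_finite G.
Variable o : vertex G.
Implicit Types (x y : vertex G) (a b c e f : edge G) (p q : seq (edge G)).

Definition out_seq x : seq (edge G) := enum_fset (fset_set (out_edges x)).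

Lemma mem_out_seq x e : (e \in out_seq x) = (etail e == x).
Proof.
have -> : (e \in out_seq x) = (e \in fset_set (out_edges x)) by [].
by rewrite in_fset_set //; apply/idP/eqP; rewrite inE.
Qed.

Lemma uniq_out_seq x : uniq (out_seq x). Proof. exact: fset_uniq. Qed.

Lemma size_out_seq x : size (out_seq x) = degree x. Proof. by []. Qed.

Definition tails k e := cnt [set p | [/\ path step e p, size p = k & ehead (last e p) = o]].

Definition nb_paths k x : nat :=
  if k is j.+1 then (\sum_(e <- out_seq x) tails j e)%N else (x == o).

Let finite_tails k e :
  finite_set [set p | [/\ path step e p, size p = k & ehead (last e p) = o]].
Proof. by apply: sub_finite_set (finite_paths lfG e k) => p []. Qed.

Lemma tails0 e : tails 0 e = (ehead e == o).
Proof.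
have [eo|/eqP eo] := eqVneq (ehead e) o; last first.
  by apply: cnt_set0 => p [_ /size0nil ->].
apply/eqP; rewrite eqn_leq; apply/andP; split.
  by apply: cnt_leq1 => p q [_ /size0nil -> _] [_ /size0nil -> _].
by apply: (@cnt_gt0 _ _ [::]); first exact: finite_tails.
Qed.

(** Every nonbacktracking path from the head of [e] continues [e], except when it
begins with the reverse of [e]. *)
Lemma tailsS k e : (tails k.+1 e + tails k (erev e) = nb_paths k.+1 (ehead e))%N.
Proof.
rewrite {1}/tails (@cnt_sum _ _ (head e) _ (out_seq (ehead e))) ?uniq_out_seq //; last first.
  by move=> [|f p] [] //= /andP[/andP[/eqP -> _] _] _ _; rewrite mem_out_seq.
have er : erev e \in out_seq (ehead e) by rewrite mem_out_seq etail_erev.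
rewrite /= (bigD1_seq (erev e)) ?uniq_out_seq //= [in RHS](bigD1_seq (erev e)) ?uniq_out_seq //=.
rewrite cnt_set0 ?add0n; last first.
  by move=> [|f p] [] [] //= /andP[+ _] _ _ fE; rewrite fE stepNN.
rewrite addnC; congr addn; rewrite big_seq_cond [RHS]big_seq_cond.
apply: eq_bigr => f /andP[]; rewrite mem_out_seq => /eqP tf nf.
apply/eqP; rewrite eqn_leq; apply/andP; split.
  apply: (@leq_cnt_inj _ _ behead); first exact: finite_tails.
    by move=> [|g p] [] [] //= /andP[_ gp] [sp] lp gf; rewrite -gf.
  by move=> [|g p] [|h q] [] [] //= _ _ _ -> [] [] //= _ _ _ -> ->.
apply: (@leq_cnt_inj _ _ (cons f)).
- by apply: sub_finite_set (finite_tails k.+1 e) => p [].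
- by move=> p [fp sp lp]; split=> //; split; rewrite /= ?sp // /step tf eqxx nf.
- by move=> p q _ _ [].
Qed.

Lemma nb_pathsS k : nb_paths k.+1 o = num_nb k.+1 o.
Proof.
rewrite num_nbE (@cnt_sum _ _ ohead _ (map Some (out_seq o))); first last.
- move=> p /nbcycle_cons[a [q [-> _ _ ta _]]] /=; rewrite map_f //.
  by rewrite mem_out_seq ta.
- by rewrite map_inj_uniq ?uniq_out_seq // => a b [].
- exact: finite_nbcycle.
rewrite big_map /= big_seq [RHS]big_seq; apply: eq_bigr => e.
rewrite mem_out_seq => /eqP te; apply/eqP; rewrite eqn_leq; apply/andP; split.
  apply: (@leq_cnt_inj _ _ (cons e)).
  - by apply: sub_finite_set (finite_nbcycle lfG o k.+1) => p [].
  - by move=> p [ep sp lp]; split=> //; apply/nbcycle_consP; rewrite sp.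
  - by move=> p q _ _ [].
apply: (@leq_cnt_inj _ _ behead); first exact: finite_tails.
  by move=> p [] /nbcycle_cons[a [q [-> [->] aq ta la]]] /= [<-].
move=> p p' [] /nbcycle_cons[a [q [-> _ _ _ _]]] /= [->].
by move=> [] /nbcycle_cons[a' [q' [-> _ _ _ _]]] /= [->] ->.
Qed.

(** Walks to [o] made of [n] arbitrary steps followed by a nonbacktracking path of
length [k]. *)
Fixpoint walk_nb n k x : nat :=
  if n is m.+1 then (\sum_(e <- out_seq x) walk_nb m k (ehead e))%N else nb_paths k x.

Lemma walk_nb_S0 n x : walk_nb n.+1 0 x = walk_nb n 1 x.
Proof.
elim: n x => [|n IHn] x /=; first by apply: eq_bigr => e _; rewrite tails0.
by apply: eq_bigr => e _; exact: IHn.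
Qed.

Variable D : nat.
Hypothesis regG : regular G D.+1.

Let sum_out x n : (\sum_(e <- out_seq x) n = D.+1 * n)%N.
Proof. by rewrite big_const_seq count_predT size_out_seq regG iter_addn_0 mulnC. Qed.

Lemma sum_nb_paths k x : (\sum_(e <- out_seq x) nb_paths k.+1 (ehead e) =
  nb_paths k.+2 x + \sum_(e <- out_seq x) tails k (erev e))%N.
Proof. by under eq_bigr => e _ do rewrite -tailsS; rewrite big_split. Qed.

Lemma walk_nb_S1 n x : (walk_nb n.+1 1 x = walk_nb n 2 x + D.+1 * walk_nb n 0 x)%N.
Proof.
elim: n x => [|n IHn] x.
  have := sum_nb_paths 0 x; rewrite /= => ->; congr addn; rewrite -(sum_out x).
  rewrite big_seq [RHS]big_seq; apply: eq_bigr => e; rewrite mem_out_seq => /eqP te.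
  by rewrite tails0 ehead_erev te.
transitivity (\sum_(e <- out_seq x) walk_nb n.+1 1 (ehead e))%N => //.
by under eq_bigr => e _ do rewrite IHn; rewrite big_split -big_distrr.
Qed.

(** A step followed by a nonbacktracking path either extends it or cancels its
first edge; a given path of length [k.+1] arises by cancellation from each of
the [D] edges at its origin other than its own first edge. *)
Lemma walk_nb_SS n k x :
  (walk_nb n.+1 k.+2 x = walk_nb n k.+3 x + D * walk_nb n k.+1 x)%N.
Proof.
elim: n x => [|n IHn] x.
  have := sum_nb_paths k.+1 x; rewrite /= => ->; congr addn.
  apply: (@addIn (\sum_(e <- out_seq x) tails k e)%N).
  rewrite -big_split /= -mulSnr -(sum_out x) big_seq [RHS]big_seq.
  apply: eq_bigr => e; rewrite mem_out_seq => /eqP te.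
  by have := tailsS k (erev e); rewrite erevK ehead_erev te.
transitivity (\sum_(e <- out_seq x) walk_nb n.+1 k.+2 (ehead e))%N => //.
by under eq_bigr => e _ do rewrite IHn; rewrite big_split -big_distrr.
Qed.

Local Open Scope ring_scope.

Lemma transition_walk (R : realType) n x :
  transition R n x o * D.+1%:R ^+ n = (walk_nb n 0 x)%:R.
Proof.
elim: n x => [|n IHn] x /=; first by rewrite expr0 mulr1.
rewrite fsbig_finite //= -/(out_seq x) mulr_suml natr_sum regG.
apply: eq_bigr => e _; rewrite -IHn exprS mulrACA mulVf ?mul1r // pnatr_eq0.
Qed.

End WalkDecomposition.

Local Open Scope ring_scope.

(** * Exponential growth rates *)

Section ExponentialGrowth.
Variable R : realType.
Implicit Types (a : nat -> R) (mu nu C K v : R).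

Definition exp_bounded a mu := exists C, forall n, a n <= C * mu ^+ n.

Lemma geometric_eventually mu nu C : 0 < mu -> mu < nu ->
  exists N, forall n, (N <= n)%N -> C * mu ^+ n <= nu ^+ n.
Proof.
move=> mu0 munu; have nu0 : 0 < nu by exact: lt_trans munu.
have q1 : `|mu / nu| < 1 by rewrite ger0_norm ?ltr_pdivrMr ?mul1r // divr_ge0 ?ltW.
have C1 : 0 < `|C| + 1 by rewrite ltr_wpDl.
have /cvgrPdist_lt/(_ (`|C| + 1)^-1) := cvg_expr q1.
rewrite invr_gt0 => /(_ C1)[N _ HN]; exists N => n Nn.
have := HN n Nn; rewrite /= sub0r normrN ger0_norm; last first.
  by rewrite exprn_ge0 // divr_ge0 // ltW.
rewrite expr_div_n ltr_pdivrMr ?exprn_gt0 // ltr_pdivlMl // => H.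
apply: le_trans (ltW H); rewrite ler_pM2r ?exprn_gt0 //.
by apply: le_trans (ler_norm _) _; rewrite lerDl.
Qed.

Lemma le_of_exp_bounded K mu : 0 <= K -> 0 < mu -> exp_bounded (GRing.exp K) mu -> K <= mu.
Proof.
move=> K0 mu0 [C HC]; rewrite leNgt; apply/negP => muK.
have [N /(_ N (leqnn N))] := geometric_eventually (C + 1) mu0 muK.
apply/negP; rewrite -ltNge; apply: le_lt_trans (HC N) _.
by rewrite ltr_pM2r ?exprn_gt0 // ltrDl.
Qed.

Lemma powR_rootK v n : 0 <= v -> (0 < n)%N -> (v `^ n%:R^-1) ^+ n = v.
Proof.
by move=> v0 n0; rewrite -powR_mulrn ?powR_ge0 // -powRrM mulVf ?powRr1 // pnatr_eq0 -lt0n.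
Qed.

Lemma le_exprn_limit K lam n : 0 <= K -> 0 < lam ->
  (forall mu, lam < mu -> K <= mu ^+ n) -> K <= lam ^+ n.
Proof.
move=> K0 lam0; case: n => [|n] HK.
  by have := HK (lam + 1); rewrite ltrDl expr0 => /(_ ltr01).
rewrite -(powR_rootK K0 (ltn0Sn n)) ler_pXn2r ?nnegrE ?powR_ge0 ?(ltW lam0) //.
apply/ler_addgt0Pr => e e0.
rewrite -(@ler_pXn2r _ n.+1) ?nnegrE ?powR_ge0 ?addr_ge0 ?(ltW lam0) ?(ltW e0) // powR_rootK //.
by apply: HK; rewrite ltrDl.
Qed.

Lemma exp_bounded_eventually a mu N : (forall n, 0 <= a n) -> 0 < mu ->
  (forall n, (N <= n)%N -> a n <= mu ^+ n) -> exp_bounded a mu.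
Proof.
move=> a0 mu0 HN; exists (1 + \sum_(i < N) a i / mu ^+ i) => n.
have s0 (P : pred 'I_N) : 0 <= \sum_(i < N | P i) a i / mu ^+ i.
  by apply: sumr_ge0 => i _; rewrite divr_ge0 // exprn_ge0 // ltW.
have [/HN an|nN] := leqP N n.
  by apply: le_trans an _; rewrite ler_peMl ?exprn_ge0 ?(ltW mu0) // lerDl s0.
rewrite -ler_pdivrMr ?exprn_gt0 // (bigD1 (Ordinal nN)) //= addrCA lerDl.
by rewrite addr_ge0.
Qed.

Lemma exp_bounded_le a mu nu : (forall n, 0 <= a n) -> 0 < mu -> mu <= nu ->
  exp_bounded a mu -> exp_bounded a nu.
Proof.
move=> a0 mu0 munu [C HC]; exists C => n; apply: le_trans (HC n) _.
have C0 : 0 <= C by have := le_trans (a0 0%N) (HC 0%N); rewrite expr0 mulr1.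
by apply: ler_wpM2l => //; rewrite lerXn2r ?nnegrE // ltW // (lt_le_trans mu0).
Qed.

Lemma powR_root_le v mu n : 0 < mu -> (0 < n)%N -> 0 <= v ->
  (v `^ n%:R^-1 <= mu) = (v <= mu ^+ n).
Proof.
move=> mu0 n0 v0.
by rewrite -{2}(powR_rootK v0 n0) ler_pXn2r // nnegrE ?powR_ge0 // ltW.
Qed.

Lemma powR_root_ge v mu n : 0 < mu -> (0 < n)%N -> 0 <= v ->
  (mu <= v `^ n%:R^-1) = (mu ^+ n <= v).
Proof.
move=> mu0 n0 v0.
by rewrite -{2}(powR_rootK v0 n0) ler_pXn2r // nnegrE ?powR_ge0 // ltW.
Qed.

Lemma limn_esup_root_lt a mu : (forall n, 0 <= a n) -> 0 < mu ->
  (limn_esup (fun n => (a n `^ n%:R^-1)%:E) < mu%:E)%E -> exp_bounded a mu.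
Proof.
move=> a0 mu0 /ereal_inf_lt[_ [V [N _ NV] <-] supV].
apply: (@exp_bounded_eventually _ _ N.+1) => // n Nn.
rewrite -powR_root_le //; last exact: leq_ltn_trans Nn.
rewrite -lee_fin; apply: le_trans (ltW supV); apply: ereal_sup_ubound.
by exists n => //; apply: NV => /=; exact: ltnW.
Qed.

Lemma limn_esup_root_le a mu : (forall n, 0 <= a n) -> 0 < mu ->
  exp_bounded a mu -> (limn_esup (fun n => (a n `^ n%:R^-1)%:E) <= mu%:E)%E.
Proof.
move=> a0 mu0 [C HC]; apply/lee_addgt0Pr => e e0.
have mue : mu < mu + e by rewrite ltrDl.
have [N HN] := geometric_eventually C mu0 mue.
apply: ereal_inf_le; exists (ereal_sup [set (a n `^ n%:R^-1)%:E | n in [set n | (N.+1 <= n)%N]]).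
  by exists [set n | (N.+1 <= n)%N] => //; exists N.+1.
apply: ge_ereal_sup => _ [n /= Nn <-]; rewrite lee_fin powR_root_le ?addr_gt0 //.
  by apply: le_trans (HC n) (HN n (ltnW Nn)).
exact: leq_ltn_trans Nn.
Qed.

(** Only bounds valid up to a constant are needed to locate an upper growth rate, and
they are much easier to transport than roots. *)
Lemma limn_esup_root_leP a lam : (forall n, 0 <= a n) -> 0 <= lam ->
  (limn_esup (fun n => (a n `^ n%:R^-1)%:E) <= lam%:E)%E <->
  (forall mu, lam < mu -> exp_bounded a mu).
Proof.
move=> a0 lam0; split=> [ale mu lmu|H].
  apply: limn_esup_root_lt => //; first exact: le_lt_trans lmu.
  by apply: le_lt_trans ale _; rewrite lte_fin.
apply/lee_addgt0Pr => e e0; rewrite -EFinD; apply: limn_esup_root_le => //.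
  by rewrite ltr_wpDl.
by apply: H; rewrite ltrDl.
Qed.

End ExponentialGrowth.

(** * Bounds in terms of the growth rate *)

Section Rates.
Variables (R : realType) (G : multigraph).
Hypothesis lfG : locally_finite G.
Hypothesis connG : connected_graph G.
Implicit Types (x y : vertex G) (a b c e f g z : edge G) (p q w : seq (edge G)).
Implicit Types (mu nu lam C : R).

Definition rate_le x mu := exp_bounded (fun n => (num_nb n x)%:R) mu.

Lemma rate_neighbour g mu : 0 < mu -> etail g <> ehead g ->
  rate_le (ehead g) mu -> rate_le (etail g) mu.
Proof.
move=> mu0 nlg [C HC]; set y := ehead g in HC.
have C0 : 0 <= C.
  by have := HC 0%N; rewrite expr0 mulr1; apply: le_trans; rewrite ler0n.
exists (C * (mu ^+ 2 + 2 + mu ^- 2)) => n.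
have := num_nb_neighbour lfG n nlg; rewrite -(ler_nat R) !natrD -/y.
move=> /le_trans; apply.
have mun : 0 <= mu ^+ n by rewrite exprn_ge0 // ltW.
have H2 : (num_nb (n - 2) y)%:R <= C * mu ^- 2 * mu ^+ n.
  have [n2|n2] := leqP n 1.
    rewrite (_ : n - 2 = 0)%N ?num_nb0; last lia.
    by rewrite !mulr_ge0 // invr_ge0 exprn_ge0 // ltW.
  apply: le_trans (HC _) _; rewrite -mulrA ler_wpM2l //.
  by rewrite -{2}(subnK n2) exprD mulrCA mulVf ?mulr1 // expf_neq0 ?gt_eqF.
have H1 := HC n; have := HC n.+2; rewrite -addn2 exprD.
set A := mu ^+ n in mun H1 H2 *; set B := mu ^+ 2; set D := mu ^- 2 in H2 *.
move=> H3; nra.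
Qed.

Lemma rate_connected x y mu : 0 < mu -> rate_le x mu -> rate_le y mu.
Proof.
move=> mu0 Hx; have [->//|/eqP yx] := eqVneq y x.
have [e [q [eq <- hx]]] := connG yx.
elim: q e eq hx {yx} => [|f q IHq] e /=.
  move=> _ hx; rewrite -hx in Hx.
  have [el|/eqP el] := eqVneq (etail e) (ehead e); first by rewrite el.
  exact: rate_neighbour.
rewrite /is_path /= => /andP[/eqP ef fq] hx.
have Hf : rate_le (etail f) mu by apply: IHq.
rewrite -ef in Hf.
have [el|/eqP el] := eqVneq (etail e) (ehead e); first by rewrite el.
exact: rate_neighbour.
Qed.

(** Supermultiplicativity removes the constant from an exponential bound. *)
Lemma nbwalks_le_rate a lam n : 0 < lam ->
  (forall mu, lam < mu -> rate_le (etail a) mu) ->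
  (nbwalks a a n)%:R <= lam ^+ n :> R.
Proof.
move=> lam0 Hlam; case: n => [|n]; first by rewrite nbwalks0 // expr0.
apply: le_exprn_limit => // mu lmu; have mu0 := lt_trans lam0 lmu.
have [C HC] := Hlam _ lmu.
apply: le_of_exp_bounded; rewrite ?exprn_gt0 //.
exists (1 + C) => k; rewrite -natrX -exprM mulnC mulrDl mul1r.
case: k => [|k].
  rewrite expn0 mul0n expr0 mulr1 lerDl.
  by have := HC 0%N; rewrite expr0 mulr1; apply: le_trans; rewrite ler0n.
have := HC (k.+1 * n.+1)%N; have := nbwalks_exp lfG a n.+1 k.+1.
have := @nbwalks_nbcycle _ lfG a (k.+1 * n.+1) isT; rewrite -!(ler_nat R).
move=> H1 H2 H3; rewrite (le_trans H2) // (le_trans H1) // (le_trans H3) // lerDr.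
by rewrite exprn_ge0 // ltW.
Qed.

Lemma num_nb_le_turns x lam m : 0 < lam ->
  (forall mu, lam < mu -> rate_le x mu) -> (0 < num_nb m.+1 x)%N ->
  exists2 b, etail b = x & (num_nb m.+1 x)%:R <=
    lam ^+ m.+1 + (nbwalks b (erev b) m)%:R + (nbwalks b b m.+1)%:R.
Proof.
move=> lam0 Hlam nb0; have [b [tb Hb]] := num_nb_dominant lfG nb0.
exists b => //; rewrite -addrA -natrD; set h := (_ + _)%N in Hb *.
suff : (num_nb m.+1 x - h)%:R <= lam ^+ m.+1 :> R.
  rewrite -(lerD2r h%:R) -natrD; apply: le_trans.
  by rewrite ler_nat; lia.
apply: le_exprn_limit => // mu lmu; have mu0 := lt_trans lam0 lmu.
have [C HC] := Hlam _ lmu.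
apply: le_of_exp_bounded; rewrite ?exprn_gt0 //.
exists (C * mu ^+ m.+1) => k; rewrite -natrX -exprM mulnC -mulrA -exprD -mulSn.
apply: le_trans (HC _); rewrite ler_nat; apply: leq_trans (Hb k).
by rewrite leq_pmulr.
Qed.

Lemma nbwalks_loop1 a : nbwalks a a 1 = 0%N.
Proof.
apply: cnt_set0 => w [sw pw lw]; case: w sw pw lw => [|b [|c w]] //= _.
rewrite andbT => /andP[/eqP + /eqP +] ba; rewrite ba => ha na; apply: na.
by have [_ ->] := erev_loop a.
Qed.

Lemma nbwalks_size0 a b : (nbwalks a b 0 <= 1)%N.
Proof. by apply: cnt_leq1 => v w [/size0nil -> _ _] [/size0nil -> _ _]. Qed.

(** A loop followed by itself backtracks, so cycles of length 1 need their own
argument; here [1 <= lam] is essential, as a single loop shows. *)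
Lemma num_nb1_le x lam : 1 <= lam -> (forall mu, lam < mu -> rate_le x mu) ->
  (num_nb 1 x)%:R <= 2 * lam.
Proof.
move=> lam1 Hlam; have lam0 : 0 < lam by exact: lt_le_trans lam1.
have [nb0|] := posnP (num_nb 1 x); first by rewrite nb0; nra.
move/(num_nb_le_turns lam0 Hlam)=> [b _]; rewrite nbwalks_loop1.
have := nbwalks_size0 b (erev b); rewrite -(ler_nat R) expr1; lra.
Qed.

Lemma num_fnb_le x lam n : 1 <= lam -> (forall mu, lam < mu -> rate_le x mu) ->
  (0 < n)%N -> (num_fnb n x)%:R <= 2 * lam ^+ n.
Proof.
move=> lam1 Hlam; have lam0 : 0 < lam by exact: lt_le_trans lam1.
case: n => [//|m _].
pose F := [set p : seq (edge G) | fully_nb_cycle x p /\ size p = m.+1].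
have FT p : F p -> nbcycle x m.+1 p by case=> /andP[].
case: m => [|m] in F FT *.
  apply: le_trans (num_nb1_le lam1 Hlam); rewrite ler_nat; apply: leq_cnt FT.
  exact: finite_nbcycle.
have [nb0|] := posnP (num_nb m.+2 x).
  have /leq_cnt := FT => /(_ (finite_nbcycle lfG _ _)).
  rewrite -num_nbE nb0 leqn0 => /eqP F0.
  by rewrite [num_fnb _ _]F0 mulr_ge0 // exprn_ge0 // ltW.
move/(num_nb_le_turns lam0 Hlam)=> [b tb]; set N := nbwalks b _ _.
have HN : (num_fnb m.+2 x + N <= num_nb m.+2 x)%N.
  rewrite num_nbE.
  have HN : (N <= cnt (cons b @` nbwalk b (erev b) m.+1))%N.
    apply: (@leq_cnt_inj _ _ (cons b)) => [|q Hq|q q' _ _ []//].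
      by apply: finite_image; exact: finite_nbwalk.
    by exists q.
  apply: leq_trans (leq_add (leqnn _) HN) _; apply: leq_cntD.
  - exact: finite_nbcycle.
  - exact: FT.
  - move=> _ [q [sq pq lq] <-]; apply/nbcycle_consP.
    by rewrite sq lq ehead_erev.
  - move=> p [/andP[_ Fp] sp] [q [sq pq lq] qp]; rewrite -qp /= sq in Fp.
    by rewrite lq eqxx in Fp.
have := nbwalks_le_rate m.+2 lam0 (a := b).
rewrite tb => /(_ Hlam); move: HN; rewrite -(ler_nat R) natrD; lra.
Qed.

(** A bound at one recurrent edge suffices: [num_nb_le_through] splits the
cycles at its tail into those absorbed by a closed walk through [a], and those
turning back along one of the two ends of that walk, which [turns_le] bounds. *)
Lemma rate_le_of_nbwalks a nu C : recurrent a -> 1 <= nu ->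
  (forall n, (nbwalks a a n)%:R <= C * nu ^+ n) -> rate_le (etail a) nu.
Proof.
move=> [q [pq qa]] nu1 HC; have nu0 : 0 < nu by exact: lt_le_trans nu1.
have C0 : 0 <= C.
  by have := HC 0%N; rewrite expr0 mulr1; apply: le_trans; rewrite ler0n.
set L := (size q).+1.
pose z := erev (last a q).
have [q' [E sq' pq' qz]] := nbwalk_reverse pq qa; rewrite -/z in E pq' qz.
pose D := C * nu ^+ L + 1.
have D0 : 0 <= D by rewrite addr_ge0 // mulr_ge0 // exprn_ge0 // ltW.
have mono i j : (i <= j)%N -> nu ^+ i <= nu ^+ j by move=> ij; rewrite ler_weXn2l.
have Ha n : (nbwalks a a n)%:R <= D * nu ^+ n.
  apply: le_trans (HC n) _; rewrite ler_wpM2r ?exprn_ge0 ?(ltW nu0) //.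
  apply: le_trans (_ : C * nu ^+ L <= _); last by rewrite lerDl.
  by rewrite ler_peMr // exprn_ege1.
have Hz n : (nbwalks z z n)%:R <= D * nu ^+ n.
  case: n => [|n]; first by rewrite nbwalks0 // expr0 mulr1 lerDr mulr_ge0 // exprn_ge0 // ltW.
  have := nbwalks_shift lfG n pq qa (erefl z); rewrite -(ler_nat R) => /le_trans; apply.
  apply: le_trans (HC _) _; rewrite exprD mulrDl mulrCA mulrC lerDl mul1r.
  by rewrite exprn_ge0 // ltW.
have turn c r : path step c r -> step (last c r) c -> size r = size q ->
    (forall n, (nbwalks c c n)%:R <= D * nu ^+ n) ->
    forall m, (nbwalks c (erev c) m)%:R <= (2 * L%:R * D * nu ^+ L + 1) * nu ^+ m.+1.
  move=> pr rc sr Hc m; have := nbwalks_turn_le lfG pr rc m.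
  rewrite -(ler_nat R) natrD natrM natr_sum sr -/L => /le_trans; apply.
  rewrite [leRHS]mulrDl mul1r; apply: lerD; last exact: exprn_ege1.
  rewrite -!mulrA ler_wpM2l //.
  apply: le_trans (_ : \sum_(j < L) D * nu ^+ (m.+1 + L) <= _).
    apply: ler_sum => j _; apply: le_trans (Hc _) _; rewrite ler_wpM2l //.
    by apply: mono; exact: leq_subr.
  by rewrite sumr_const card_ord -[X in X <= _]mulr_natl exprD (mulrC (nu ^+ m.+1)).
exists (2 * D * nu ^+ L + 2 * (2 * L%:R * D * nu ^+ L + 1)) => n.
case: n => [|m].
  by rewrite num_nb0 expr0 mulr1 addr_ge0 // !mulr_ge0 ?addr_ge0 ?mulr_ge0 ?exprn_ge0 ?(ltW nu0).
have := num_nb_le_through lfG m pq qa (erefl z); rewrite -(ler_nat R) natrD natrM natrD -/L.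
have := Ha (m.+1 + L)%N; have := turn _ _ pq qa erefl Ha m; have := turn _ _ pq' qz sq' Hz m.
rewrite exprD; set T := (2 * L%:R * D * nu ^+ L + 1); set X := nu ^+ m.+1; set Y := nu ^+ L.
lra.
Qed.

End Rates.

(** * Lower bounds along the lengths that occur *)

Section LowerBound.
Variables (R : realType) (G : multigraph).
Hypothesis lfG : locally_finite G.
Implicit Types (x y : vertex G) (a b c e f g z : edge G) (p q w : seq (edge G)).
Variables (nu : R).
Hypothesis nu_rate : forall x, ~ rate_le x nu.

(** Some [M] has more than [nu ^ M] closed walks at [a].  For each residue modulo
[M] attained by the length of a cycle starting with [a], fix one such cycle and insert
closed walks of length a multiple of [M] before it. *)
Lemma num_nb_eventually_ge_from a mu : recurrent a -> 1 <= mu -> mu < nu ->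
  \forall n \near \oo, forall q, nbcycle (etail a) n (a :: q) ->
    mu ^+ n <= (num_nb n (etail a))%:R.
Proof.
move=> ra mu1 munu; have mu0 : 0 < mu by exact: lt_le_trans mu1.
have nu1 : 1 <= nu by rewrite (le_trans mu1) // ltW.
have nu0 : 0 < nu by exact: lt_le_trans nu1.
have [M HM] : exists M, nu ^+ M < (nbwalks a a M)%:R.
  apply: contrapT => nM; apply: (nu_rate (x := etail a)).
  apply: (rate_le_of_nbwalks lfG (C := 1) ra nu1) => M.
  by rewrite mul1r leNgt; apply/negP => HM; apply: nM; exists M.
have M0 : (0 < M)%N.
  by case: M HM => [|//]; rewrite nbwalks0 // expr0 ltxx.
have Hr (r : 'I_M) : \forall n \near \oo, (n %% M = r)%N ->
    forall q, nbcycle (etail a) n (a :: q) -> mu ^+ n <= (num_nb n (etail a))%:R.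
  have [[s [q [sr Ts]]]|no] := EM (exists s q, (s %% M = r)%N /\ nbcycle (etail a) s (a :: q)).
    have [N0 HN0] := geometric_eventually (nu ^+ s) mu0 munu.
    exists (maxn N0 s) => // n /=; rewrite geq_max => /andP[Nn sn] nr _ _.
    have nE : n = (((n - s) %/ M) * M + s)%N.
      have : (M %| n - s)%N by rewrite -eqn_mod_dvd // nr sr.
      by move=> /divnK ->; rewrite subnK.
    have := HN0 _ Nn; set k := ((n - s) %/ M)%N in nE *.
    rewrite [in nu ^+ n]nE exprD mulrC.
    rewrite ler_pM2r ?exprn_gt0 // => /le_trans; apply.
    have := nbwalks_insert lfG (k * M) Ts; rewrite -nE -(ler_nat R); apply: le_trans.
    have := nbwalks_exp lfG a M k; rewrite -(ler_nat R); apply: le_trans.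
    by rewrite mulnC exprM natrX lerXn2r ?nnegrE ?exprn_ge0 ?ler0n ?(ltW nu0) ?(ltW HM).
  exists 0%N => // n _ nr q Tq; exfalso; apply: no.
  by exists n, q.
apply: filterS (filter_forall _ Hr) => n Hn q Tq.
by apply: (Hn (Ordinal (ltn_pmod n M0)) _ q).
Qed.

(** When some first edge at [x] is transient, every cycle at [x] passes through it
and the claim is inherited from the other end of that edge, where the shortest
cycle is shorter. *)
Lemma num_nb_eventually_ge s x mu : 1 <= mu -> mu < nu -> (0 < num_nb s x)%N ->
  \forall n \near \oo, (0 < num_nb n x)%N -> mu ^+ n <= (num_nb n x)%:R.
Proof.
elim/ltn_ind: s x mu => s IHs x mu mu1 munu nbs.
have mu0 : 0 < mu by exact: lt_le_trans mu1.
have [[a [r [n0 [nra Ta]]]]|rec] :=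
  EM (exists a r n, ~ recurrent a /\ nbcycle x n (a :: r)).
  have [la|nla] := eqVneq (etail a) (ehead a).
    exists 2%N => // n /= n2; rewrite num_nbE => /cnt_gt0_ex[p Tp].
    by have := transient_loop nra Ta Tp la; rewrite leqNgt n2.
  move/eqP : nla => nla.
  have strip n : (0 < num_nb n x)%N -> (1 < n)%N /\ (0 < num_nb (n - 2) (ehead a))%N.
    rewrite num_nbE => /cnt_gt0_ex[p Tp].
    have [hp lp] := transient_turns nra Ta Tp.
    have n1 := transient_nonloop Tp hp nla lp; split=> //.
    have [q [_ Tq]] := turn_strip Tp hp lp n1.
    by apply: cnt_gt0 Tq; exact: finite_nbcycle.
  have [s1 nbs2] := strip _ nbs.
  pose mu' := (mu + nu) / 2.
  have mumu' : mu < mu' by rewrite /mu'; lra.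
  have mu'nu : mu' < nu by rewrite /mu'; lra.
  have := IHs (s - 2)%N _ (ehead a) mu' _ mu'nu nbs2.
  move=> /(_ ltac:(lia) ltac:(lra))[N _ HN].
  have [N1 HN1] := geometric_eventually (mu ^+ 2) mu0 mumu'.
  exists (N + N1 + 2)%N => // n /= Nn /strip[n1 nbn].
  have /HN/(_ nbn) : (N <= n - 2)%N by lia.
  have /HN1 : (N1 <= n - 2)%N by lia.
  rewrite -exprD subnKC // => H1 H2; apply: (le_trans H1); apply: (le_trans H2).
  rewrite ler_nat; exact: num_nb_transient Ta _.
have Ha a : etail a = x -> \forall n \near \oo, forall q, nbcycle x n (a :: q) ->
    mu ^+ n <= (num_nb n x)%:R.
  move=> ta; have [ra|nra] := EM (recurrent a).
    by rewrite -ta; exact: num_nb_eventually_ge_from.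
  exists 0%N => // n _ q Tq; exfalso; apply: rec.
  by exists a, q, n.
have Hs (t : seq (edge G)) : (forall a, a \in t -> etail a = x) ->
    \forall n \near \oo, forall a q, a \in t -> nbcycle x n (a :: q) ->
    mu ^+ n <= (num_nb n x)%:R.
  elim: t => [|a t IHt] Ht; first by exists 0%N.
  have H1 := Ha a (Ht a (mem_head _ _)).
  have H2 : \forall n \near \oo, forall b q, b \in t -> nbcycle x n (b :: q) ->
      mu ^+ n <= (num_nb n x)%:R.
    by apply: IHt => b bt; apply: Ht; rewrite inE bt orbT.
  apply: filterS2 H1 H2 => n K1 K2 b q; rewrite inE => /orP[/eqP ->|]; first exact: K1.
  exact: K2.
have [t [_ _ tE]] := cnt_enum (lfG x).
apply: filterS (Hs t (fun a => (tE a).1)) => n Hn.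
rewrite num_nbE => /cnt_gt0_ex[p Tp]; have [a [q [pE _ _ ta _]]] := nbcycle_cons Tp.
by rewrite pE in Tp; apply: Hn Tp; apply/tE.
Qed.

End LowerBound.

(** * Vertices on simple cycles *)

Section SimpleCycles.
Variables (R : realType) (G : multigraph).
Hypothesis lfG : locally_finite G.
Implicit Types (x y : vertex G) (a b c e f g z : edge G) (p q w : seq (edge G)).
Variables (lam : R).
Hypothesis lam_ge1 : 1 <= lam.
Hypothesis rate_lam : forall x mu, lam < mu -> rate_le x mu.

Let lam_gt0 : 0 < lam. Proof. exact: lt_le_trans lam_ge1. Qed.

Let walks_le a n : (nbwalks a a n)%:R <= lam ^+ n :> R.
Proof. by apply: nbwalks_le_rate => //; exact: rate_lam. Qed.

Lemma nbwalks_turn_inner b m : (nbwalks b (erev b) m.+1 <= num_nb m (ehead b))%N.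
Proof.
apply: (@leq_cnt_inj _ _ (fun w => behead (belast b w))); first exact: finite_nbcycle.
  move=> w [sw pw]; case/lastP: w sw pw => [//|w d].
  rewrite size_rcons last_rcons => -[sw] + dE; rewrite {}dE rcons_path.
  rewrite belast_rcons /=; case: w sw => [|c w] sw; first by rewrite /= stepNN.
  move=> /= /andP[/andP[bc cw] wb]; apply/nbcycle_consP; split=> //.
    by move: bc => /andP[/eqP].
  by move: wb => /andP[/eqP ->]; rewrite etail_erev.
move=> w w' [sw _ lw] [sw' _ lw'] E.
have E' : belast b w = belast b w'.
  by case: w w' sw sw' E {lw lw'} => [|c w] [|c' w'] //= _ _ ->.
have [] // : b :: w = b :: w' by rewrite !lastI E' lw lw'.
Qed.

(** The constant [C = 2 + 2 / lam] satisfies [2 + C / lam ^ 2 <= C] exactly when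
[lam + 1 <= lam ^ 2], which is what the induction needs. *)
Lemma num_nb_le_golden x n : lam + 1 <= lam ^+ 2 ->
  (num_nb n x)%:R <= (2 + 2 / lam) * lam ^+ n.
Proof.
move=> golden; have lamV : 0 < lam^-1 by rewrite invr_gt0.
elim/ltn_ind: n x => -[|m] IHm x.
  by rewrite num_nb0 mulr_ge0 ?exprn_ge0 ?(ltW lam_gt0) //; lra.
have P0 : 0 < lam ^+ m by rewrite exprn_gt0.
have [->|nb0] := posnP (num_nb m.+1 x).
  by rewrite mulr_ge0 ?exprn_ge0 ?(ltW lam_gt0) //; lra.
have [b tb Hb] := num_nb_le_turns lfG lam_gt0 (@rate_lam x) nb0.
have Hw := walks_le b m.+1.
suff : (nbwalks b (erev b) m)%:R <= 2 / lam * lam ^+ m.+1 by lra.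
rewrite exprS mulrA mulfVK ?gt_eqF //.
case: m {Hb Hw nb0} IHm P0 => [|k] IHk P0.
  by have := nbwalks_size0 b (erev b); rewrite -(ler_nat R) expr0; lra.
have := nbwalks_turn_inner b k; rewrite -(ler_nat R) => /le_trans; apply.
apply: le_trans (IHk k _ _) _ => //; rewrite exprS mulrA ler_pM2r ?exprn_gt0 //.
rewrite -(ler_pM2r lam_gt0) mulrDl mulfVK ?gt_eqF // -mulrA -expr2; lra.
Qed.

(** After coming back along the reverse of [b], go once around the cycle [a :: q]
and take [b] again. *)
Lemma nbwalks_turn_off a q b m : path step a q -> step (last a q) a ->
  etail b = etail a -> b <> a -> b <> erev (last a q) ->
  (nbwalks b (erev b) m <= nbwalks b b (m + (size q).+2))%N.
Proof.
move=> pq qa tb ba bz; apply: (@leq_cnt_inj _ _ (fun w => w ++ a :: rcons q b)).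
- exact: finite_nbwalk.
- move=> w [sw pw lw]; split.
  + by rewrite size_cat /= size_rcons sw.
  + rewrite cat_path pw lw /= rcons_path pq /=; apply/andP; split; apply: stepI.
    * by rewrite ehead_erev.
    * by rewrite erevK => E; apply: ba.
    * by move: qa => /andP[/eqP ->].
    * exact: bz.
  + by rewrite last_cat /= last_rcons.
- move=> w w' [sw _ _] [sw' _ _] /eqP.
  by rewrite eqseq_cat ?sw ?sw' // => /andP[/eqP].
Qed.

Lemma num_nb_le_cycle a q n : path step a q -> step (last a q) a -> (0 < size q)%N ->
  (forall e, e \in a :: q -> erev e <> e) -> lam ^+ 2 <= 2 * (size q).+1%:R ->
  (num_nb n (etail a))%:R <= (2 + 2 * (size q).+1%:R * lam ^+ (size q).-1) * lam ^+ n.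
Proof.
move=> pq qa q0 nl lamL.
have P k : 0 <= lam ^+ k by rewrite exprn_ge0 // ltW.
have C0 : 0 <= 2 + 2 * (size q).+1%:R * lam ^+ (size q).-1.
  by rewrite addr_ge0 // !mulr_ge0.
case: n => [|m]; first by rewrite num_nb0 mulr_ge0.
have [->|nb0] := posnP (num_nb m.+1 (etail a)); first by rewrite mulr_ge0.
have [b tb Hb] := num_nb_le_turns lfG lam_gt0 (@rate_lam (etail a)) nb0.
have Hw := walks_le b m.+1.
suff : (nbwalks b (erev b) m)%:R <= 2 * (size q).+1%:R * lam ^+ (size q).-1 * lam ^+ m.+1 by lra.
have turn c r : path step c r -> step (last c r) c -> size r = size q ->
    (forall e, e \in c :: r -> erev e <> e) ->
    (nbwalks c (erev c) m)%:R <= 2 * (size q).+1%:R * lam ^+ (size q).-1 * lam ^+ m.+1.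
  move=> pr rc sr nlr; have := nbwalks_turn_le_loopless lfG pr rc m nlr.
  rewrite -(ler_nat R) natrM natr_sum sr => /le_trans; apply.
  rewrite -!mulrA ler_wpM2l //.
  apply: le_trans (_ : \sum_(j < (size q).+1) lam ^+ ((size q).-1 + m.+1) <= _).
    have idx (j : nat) : (m.+1 + (size q).+1 - j.+1.*2 <= (size q).-1 + m.+1)%N by clear; lia.
    apply: ler_sum => j _; apply: le_trans (walks_le _ _) _.
    by apply: ler_weXn2l.
  by rewrite sumr_const card_ord -[X in X <= _]mulr_natl exprD.
have [->|/eqP ba] := eqVneq b a; first by apply: turn pq qa erefl nl.
have [q' [E sq' pq' qz]] := nbwalk_reverse pq qa.
have [->|/eqP bz] := eqVneq b (erev (last a q)).
  apply: (turn _ _ pq' qz sq') => e; rewrite -E /reversal mem_rev => /mapP[f /nl nf ->].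
  by rewrite erevK => Ef; apply: nf.
have := nbwalks_turn_off m pq qa tb ba bz; rewrite -(ler_nat R) => /le_trans; apply.
apply: le_trans (walks_le _ _) _.
have -> : (m + (size q).+2 = 2 + ((size q).-1 + m.+1))%N by clear -q0; lia.
by rewrite exprD exprD mulrA; do 2 apply: ler_wpM2r => //.
Qed.

End SimpleCycles.

(** At a loop [c], closed walks through [c] play the role of renewal times of a
process with [c] never occurring at two consecutive times. *)
Section Loop.
Variables (R : realType) (G : multigraph).
Hypothesis lfG : locally_finite G.
Implicit Types (x y : vertex G) (a b e f g z : edge G) (p q w : seq (edge G)).
Variables (c : edge G).
Hypothesis loop_c : erev c = c.

Local Notation r := (nbwalks c c).

Lemma num_nb_loop n : (num_nb n.+1 (etail c) <= r n.+2 + r n.+1 + (r n.+1 + r n))%N.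
Proof.
have hc : ehead c = etail c by have [-> ] := erev_loop c.
pose T := nbcycle (etail c) n.+1.
pose A := [set p | T p /\ (head c p <> c /\ last c p <> c)].
pose B := [set p | T p /\ (head c p = c /\ last c p <> c)].
pose C := [set p | T p /\ (head c p <> c /\ last c p = c)].
pose D := [set p | T p /\ (head c p = c /\ last c p = c)].
have fin (P : seq (edge G) -> Prop) : finite_set [set p | T p /\ P p].
  by apply: sub_finite_set (finite_nbcycle lfG (etail c) n.+1) => p [].
have stepl p : T p -> last c p <> c -> step (last c p) c.
  move=> Tp lp; apply: stepI; first exact: nbcycle_last Tp.
  by move=> E; apply: lp; rewrite -[LHS]erevK -E loop_c.
have steph p : T p -> head c p <> c -> path step c p.
  move=> Tp hp; have [b [s [pE _ ps tb _]]] := nbcycle_cons Tp.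
  rewrite pE /= in hp *; rewrite ps andbT; apply: stepI; first by rewrite hc tb.
  by rewrite loop_c.
have cA : (cnt A <= r n.+2)%N.
  apply: (@leq_cnt_inj _ _ (rcons^~ c)) => [|p [Tp [hp lp]]|p p' _ _ /rcons_inj[]//].
    exact: finite_nbwalk.
  have [_ sp] := Tp; split; rewrite ?size_rcons ?sp ?last_rcons //.
  by rewrite rcons_path steph // stepl.
have cB : (cnt B <= r n.+1)%N.
  apply: (@leq_cnt_inj _ _ (fun p => rcons (behead p) c)); first exact: finite_nbwalk.
    move=> p [Tp [hp lp]]; have := stepl _ Tp lp.
    have [b [s [pE [sE] ps tb _]]] := nbcycle_cons Tp; rewrite pE /= in hp lp * => sc.
    rewrite hp in ps sc; rewrite sE; exact: nbwalk_rcons.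
  move=> p p' [Tp [hp _]] [Tp' [hp' _]].
  have [b [s [pE _ _ _ _]]] := nbcycle_cons Tp; have [b' [s' [pE' _ _ _ _]]] := nbcycle_cons Tp'.
  by move: hp hp'; rewrite pE pE' /= => -> -> /rcons_inj[->].
have cC : (cnt C <= r n.+1)%N.
  apply: (@leq_cnt_inj _ _ id) => [|p [Tp [hp lp]]|//]; first exact: finite_nbwalk.
  by have [_ sp] := Tp; split=> //; exact: steph.
have cD : (cnt D <= r n)%N.
  apply: (@leq_cnt_inj _ _ behead); first exact: finite_nbwalk.
    move=> p [Tp [hp lp]]; have [b [s [pE [sE] ps tb _]]] := nbcycle_cons Tp.
    by rewrite pE /= in hp lp *; rewrite hp in ps lp; split.
  move=> p p' [Tp [hp _]] [Tp' [hp' _]].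
  have [b [s [pE _ _ _ _]]] := nbcycle_cons Tp; have [b' [s' [pE' _ _ _ _]]] := nbcycle_cons Tp'.
  by move: hp hp'; rewrite pE pE' /= => -> -> ->.
rewrite num_nbE; apply: leq_trans (leq_add (leq_add cA cB) (leq_add cC cD)).
apply: (cnt_leqD4 (fin _) (fin _) (fin _) (fin _)) => p Tp; rewrite /A /B /C /D /=.
have [hp|/eqP hp] := eqVneq (head c p) c; have [la|/eqP la] := eqVneq (last c p) c; by tauto.
Qed.

(** The two families are disjoint: a walk cannot be at [c] at both times [n] and
[n.+1]. *)
Lemma nbwalks_loop_renewal n k : (r n * r k.+1 + r n.+1 * r k <= r (n + k.+1))%N.
Proof.
apply: leq_trans (leq_add (nbwalks_cat_at lfG c c c n k.+1) (nbwalks_cat_at lfG c c c n.+1 k)) _.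
rewrite addSnnS; apply: leq_cntD.
- exact: finite_nbwalk.
- by move=> w [].
- by move=> w [].
move=> w [[sw pw _] E1] [_ E2].
have := pathP c pw n; rewrite sw E1 => /(_ ltac:(lia)).
by move: E2 => /= ->; rewrite -{2}loop_c stepNN.
Qed.

Variable lam : R.
Hypothesis lam_ge1 : 1 <= lam.
Hypothesis rate_lam : forall x mu, lam < mu -> rate_le x mu.

Let v n : R := (r n)%:R / lam ^+ n.
Let lam_gt0 : 0 < lam. Proof. exact: lt_le_trans lam_ge1. Qed.
Let v_ge0 n : 0 <= v n.
Proof. by rewrite divr_ge0 // exprn_ge0 // ltW. Qed.
Let v_le1 n : v n <= 1.
Proof.
rewrite ler_pdivrMr ?exprn_gt0 // mul1r; apply: nbwalks_le_rate => //; exact: rate_lam.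
Qed.
Let vE n : (r n)%:R = v n * lam ^+ n.
Proof. by rewrite mulfVK // expf_neq0 // gt_eqF. Qed.

Let v_renewal n k : v n * v k.+1 + v n.+1 * v k <= v (n + k.+1).
Proof.
rewrite ler_pdivlMr ?exprn_gt0 //.
have := nbwalks_loop_renewal n k; rewrite -(ler_nat R) natrD !natrM !vE.
apply: le_trans; rewrite exprD !exprS; set A := lam ^+ n; set B := lam ^+ k; lra.
Qed.

(** By [v_renewal] the partial sums of [v] are multiplied by [v n + v n.+1] every
[n.+1] terms, but they grow at most linearly since [v <= 1]. *)
Let v_consecutive n : v n + v n.+1 <= 1.
Proof.
set X := v n + v n.+1; pose S K := \sum_(0 <= i < K) v i.
have X0 : 0 <= X by rewrite addr_ge0.
have S_le K : S K <= K%:R.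
  apply: le_trans (_ : \sum_(0 <= i < K) 1 <= _); first by apply: ler_sum_nat.
  by rewrite sumr_const_nat subn0.
have S_ge K : X * S K <= S (K + n.+1)%N.
  have -> : S (K + n.+1)%N = \sum_(0 <= i < n) v i + \sum_(0 <= k < K.+1) v (n + k)%N.
    rewrite /S (@big_cat_nat _ _ _ n) //=; last lia.
    congr (_ + _); rewrite -{1}[n]add0n big_addn; have -> : (K + n.+1 - n = K.+1)%N by lia.
    by apply: eq_bigr => k _; rewrite addnC.
  apply: ler_wpDl; first by apply: sumr_ge0.
  rewrite big_nat_recl // addn0.
  apply: le_trans (_ : v n + \sum_(0 <= k < K) (v n * v k.+1 + v n.+1 * v k) <= _).
    rewrite big_split /= -!mulr_sumr /X mulrDl addrA lerD2r.
    have : S K.+1 = 1 + \sum_(0 <= k < K) v k.+1.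
      by rewrite /S big_nat_recl // {1}/v nbwalks0 // expr0 divr1.
    have : S K <= S K.+1 by rewrite /S big_nat_recr //= lerDl.
    have := v_ge0 n; set U := S K; set W := \sum_(_ <= _ < _) _; nra.
  by rewrite lerD2l; apply: ler_sum => k _; exact: v_renewal.
have S_exp j : X ^+ j <= S (j * n.+1 + 1)%N.
  elim: j => [|j IHj].
    by rewrite expr0 /S big_nat1 /v nbwalks0 // expr0 divr1.
  rewrite exprS mulSn -addnA addnC; apply: le_trans (S_ge _).
  by rewrite ler_wpM2l.
apply/ler_addgt0Pr => e e0.
apply: le_of_exp_bounded; rewrite ?addr_gt0 //.
exists (n.+1%:R / e + 1) => j; apply: le_trans (S_exp j) _; apply: le_trans (S_le _) _.
have bern : 1 + j%:R * e <= (1 + e) ^+ j.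
  elim: j => [|j IHj]; first by rewrite mul0r addr0 expr0.
  rewrite exprS -natr1; have : 0 <= j%:R * e * e by rewrite !mulr_ge0 ?ler0n // ltW.
  by move: IHj; set Q := _ ^+ j => IHj; nra.
have n1 : 1 <= n.+1%:R :> R by rewrite ler1n.
apply: le_trans (_ : (n.+1%:R / e + 1) * (1 + j%:R * e) <= _); last first.
  by rewrite ler_wpM2l // addr_ge0 // divr_ge0 // ltW.
rewrite natrD natrM mulrDl mul1r mulrDr mulr1.
have -> : n.+1%:R / e * (j%:R * e) = j%:R * n.+1%:R.
  by rewrite mulrCA mulfVK ?gt_eqF.
have : 0 <= n.+1%:R / e by rewrite divr_ge0 // ltW.
have : 0 <= j%:R * e by rewrite mulr_ge0 // ltW.
lra.
Qed.

Lemma num_nb_le_loop n : lam ^+ 2 <= lam + 1 ->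
  (num_nb n (etail c))%:R <= (2 + 2 / lam) * lam ^+ n.
Proof.
move=> small; have lamV : 0 < lam^-1 by rewrite invr_gt0.
case: n => [|n].
  by rewrite num_nb0 expr0 mulr1; lra.
have := num_nb_loop n; rewrite -(ler_nat R) !natrD !vE => /le_trans; apply.
rewrite !exprS.
have arith (u0 u1 u2 : R) : 0 <= u1 -> u1 <= 1 -> 0 <= u2 -> u1 + u2 <= 1 -> u0 + u1 <= 1 ->
    u2 * lam ^+ 2 + 2 * u1 * lam + u0 <= 2 * lam + 2.
  move=> u10 u11 u20 u12 u01.
  have A : u2 * lam ^+ 2 <= u2 * (lam + 1) by exact: ler_wpM2l.
  have B : u2 * (lam + 1) <= (1 - u1) * (lam + 1).
    by apply: ler_wpM2r; [rewrite addr_ge0 // ltW|rewrite lerBrDl].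
  have C : u1 * lam <= 1 * lam by apply: ler_wpM2r => //; exact: ltW.
  lra.
have P0 : 0 < lam ^+ n by rewrite exprn_gt0.
rewrite [leLHS](_ : _ = (v n.+2 * lam ^+ 2 + 2 * v n.+1 * lam + v n) * lam ^+ n); last by ring.
rewrite [leRHS](_ : _ = (2 * lam + 2) * lam ^+ n); last by field; rewrite gt_eqF.
by rewrite ler_pM2r //; apply: arith; rewrite ?v_ge0 ?v_le1 ?v_consecutive.
Qed.

End Loop.

(** * Radial recursion on the regular tree *)

(** Here [w n k] stands for [walk_nb n k o], and [D + 1] for the degree. *)
Section Spherical.
Variables (R : realType) (D nu : R) (w : nat -> nat -> R).
Hypothesis nu_ge1 : 1 <= nu.
Hypothesis nuD : nu ^+ 2 = D.
Hypothesis w_ge0 : forall n k, 0 <= w n k.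
Hypothesis w_00 : w 0 0 = 1.
Hypothesis w_S0 : forall n, w n.+1 0 = w n 1.
Hypothesis w_S1 : forall n, w n.+1 1 = w n 2 + (D + 1) * w n 0.
Hypothesis w_SS : forall n k, w n.+1 k.+2 = w n k.+3 + D * w n k.+1.

Let nu_gt0 : 0 < nu. Proof. exact: lt_le_trans nu_ge1. Qed.
Let D_ge1 : 1 <= D. Proof. by rewrite -nuD expr_ge1 // ltW. Qed.
Let D_ge0 : 0 <= D. Proof. exact: le_trans D_ge1. Qed.

(** The sequence equal to [1 / 2] at [0] and to [nu ^ k] at [k > 0] is multiplied
by at most [2 nu] by the recursion. *)
Lemma spherical_upper C : 0 <= C -> (forall k, w 0 k <= C * nu ^+ k) ->
  forall n, w n 0 <= (C + 1) * (2 * nu) ^+ n.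
Proof.
move=> C0 HC; pose C' := 2 * (C + 1).
suff H n : w n 0 <= C' / 2 * (2 * nu) ^+ n /\
    forall k, w n k.+1 <= C' * nu ^+ k.+1 * (2 * nu) ^+ n.
  by move=> n; have [+ _] := H n; rewrite /C' [2 * _]mulrC mulfK // pnatr_eq0.
have nu2 : 0 <= 2 * nu by rewrite mulr_ge0 // ltW.
elim: n => [|n [IH0 IHk]].
  rewrite expr0 !mulr1 w_00 /C'; split; first lra.
  move=> k; rewrite mulr1; apply: le_trans (HC _) _; apply: ler_wpM2r; last by rewrite /C'; lra.
  by rewrite exprn_ge0 // ltW.
have X0 : 0 <= (2 * nu) ^+ n by rewrite exprn_ge0.
split; first by rewrite w_S0; apply: le_trans (IHk 0%N) _; rewrite expr1 exprS; lra.
case=> [|k].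
  have H1 := IHk 1%N; rewrite nuD in H1.
  have H2 : (D + 1) * w n 0 <= (D + 1) * (C' / 2 * (2 * nu) ^+ n).
    by apply: ler_wpM2l => //; rewrite addr_ge0.
  have E : nu * (2 * nu * (2 * nu) ^+ n) = 2 * D * (2 * nu) ^+ n by rewrite -nuD; ring.
  rewrite w_S1 expr1 exprS -mulrA E; set X := (2 * nu) ^+ n in X0 H1 H2 *.
  have C'0 : 0 <= C' by rewrite /C'; lra.
  have : 0 <= C' * X * (D - 1) by apply: mulr_ge0; [exact: mulr_ge0|rewrite subr_ge0].
  lra.
rewrite w_SS; have H1 := IHk k.+2.
have H2 : D * w n k.+1 <= D * (C' * nu ^+ k.+1 * (2 * nu) ^+ n) by exact: ler_wpM2l.
apply: le_trans (lerD H1 H2) _; rewrite -nuD !exprS.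
by rewrite le_eqVlt; apply/orP; left; apply/eqP; ring.
Qed.

Let w_shift n k : w n k.+1 <= w n.+1 k.
Proof.
case: k => [|[|k]]; first by rewrite w_S0.
- by rewrite w_S1 lerDl mulr_ge0 // addr_ge0.
- by rewrite w_SS lerDl mulr_ge0.
Qed.

Let w_le n k : w n k <= w (n + k) 0.
Proof.
elim: k n => [|k IHk] n; first by rewrite addn0.
by apply: le_trans (w_shift _ _) _; rewrite addnS -addSn.
Qed.

(** The generating functions [g k] of [w n k] in [n]; they converge because
[w n k <= w (n + k) 0]. *)
Lemma green_function C theta z : 0 < theta -> 0 < z -> z * theta < 1 ->
  (forall n, w n 0 <= C * theta ^+ n) -> exists g : nat -> R,
  [/\ forall k, w 0 k <= g k, g 0 = 1 + z * g 1,
      g 1 = w 0 1 + z * (g 2 + (D + 1) * g 0) &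
      forall k, g k.+2 = w 0 k.+2 + z * (g k.+3 + D * g k.+1)].
Proof.
move=> theta0 z0 zt HC; pose s k N := \sum_(0 <= n < N) w n k * z ^+ n.
have C0 : 0 <= C by have := HC 0%N; rewrite expr0 mulr1; apply: le_trans.
have zt0 : 0 <= z * theta by rewrite mulr_ge0 // ltW.
have term_ge0 n k : 0 <= w n k * z ^+ n by rewrite mulr_ge0 // exprn_ge0 // ltW.
have s_nd k : nondecreasing_seq (s k).
  apply/nondecreasing_seqP => n; rewrite /s big_nat_recr //= lerDl //.
have s_le k N : s k N <= C * theta ^+ k / (1 - z * theta).
  apply: le_trans (_ : \sum_(0 <= n < N) C * theta ^+ k * (z * theta) ^+ n <= _).
    apply: ler_sum => n _; apply: le_trans (_ : C * theta ^+ (n + k) * z ^+ n <= _).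
      by rewrite ler_wpM2r ?exprn_ge0 ?(ltW z0) // (le_trans (w_le _ _)).
    by rewrite exprD exprMn le_eqVlt; apply/orP; left; apply/eqP; ring.
  rewrite -mulr_sumr ler_wpM2l // ?mulr_ge0 ?exprn_ge0 ?(ltW theta0) //.
  rewrite -[leRHS]mul1r ler_pdivlMr ?subr_gt0 //.
  have := subrX1 (z * theta) N; rewrite big_mkord.
  have : 0 <= (z * theta) ^+ N by rewrite exprn_ge0.
  set S := \sum_(_ < _) _; set Q := _ ^+ N; lra.
have s_cvg k : s k @ \oo --> limn (s k).
  apply: nondecreasing_is_cvgn => //; exists (C * theta ^+ k / (1 - z * theta)).
  by move=> _ [N _ <-].
have sS k : (fun N => s k N.+1) @ \oo --> limn (s k).
  have := s_cvg k; rewrite -cvg_shiftS; exact.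
have s_rec k u l : (forall n, w n.+1 k = u n) ->
    (fun N => \sum_(0 <= n < N) u n * z ^+ n) @ \oo --> l -> limn (s k) = w 0 k + z * l.
  move=> wu ul; apply: (cvg_unique _ (sS k)) => //.
  have -> : (fun N => s k N.+1) =
      (fun N => w 0 k + z * \sum_(0 <= n < N) u n * z ^+ n).
    apply/funext => N; rewrite /s big_nat_recl // expr0 mulr1 mulr_sumr.
    by congr (_ + _); apply: eq_bigr => n _; rewrite wu exprS mulrCA.
  by apply: cvgD; [exact: cvg_cst|apply: cvgMr].
exists (fun k => limn (s k)); split.
- move=> k; apply: le_trans (_ : s k 1%N <= _).
    by rewrite /s big_nat1 expr0 mulr1.
  by apply: nondecreasing_cvgn_le => //; apply: cvgP (s_cvg k).
- by rewrite -w_00; apply: s_rec (s_cvg 1%N).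
- apply: (s_rec 1%N (fun n => w n 2 + (D + 1) * w n 0)) => //.
  rewrite (_ : (fun N => _) = (fun N => s 2 N + (D + 1) * s 0 N)); last first.
    apply/funext => N; rewrite /s mulr_sumr -big_split; apply: eq_bigr => n _ /=.
    by rewrite mulrDl mulrA.
  by apply: cvgD; [exact: s_cvg|apply: cvgMr].
- move=> k; apply: (s_rec k.+2 (fun n => w n k.+3 + D * w n k.+1)) => //.
  rewrite (_ : (fun N => _) = (fun N => s k.+3 N + D * s k.+1 N)); last first.
    apply/funext => N; rewrite /s mulr_sumr -big_split; apply: eq_bigr => n _ /=.
    by rewrite mulrDl mulrA.
  by apply: cvgD; [exact: s_cvg|apply: cvgMr].
Qed.

Let g_pos z (g : nat -> R) : 0 < z -> (forall k, w 0 k <= g k) -> g 0 = 1 + z * g 1 ->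
  g 1 = w 0 1 + z * (g 2 + (D + 1) * g 0) ->
  (forall k, g k.+2 = w 0 k.+2 + z * (g k.+3 + D * g k.+1)) ->
  forall k, 0 < g k.+1.
Proof.
move=> z0 wg g0 g1 gS; have gge0 k : 0 <= g k by exact: le_trans (wg k).
have g0p : 0 < g 0 by rewrite g0 ltr_wpDr // mulr_ge0 // ltW.
elim=> [|k IHk].
  rewrite g1 ltr_wpDl // mulr_gt0 // ltr_wpDl // mulr_gt0 //.
  by rewrite ltr_wpDl.
rewrite gS ltr_wpDl // mulr_gt0 // ltr_wpDl // mulr_gt0 //.
exact: lt_le_trans D_ge1.
Qed.

(** For [T < 2 nu] the inequality [g k.+3 + nu ^ 2 * g k.+1 <= T * g k.+2] makes the
ratios of consecutive terms decrease by at least [2 nu - T] at each step, by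
the arithmetic-geometric inequality, so they cannot stay positive. *)
Lemma spherical_lower C theta : 0 < theta -> theta < 2 * nu ->
  (forall n, w n 0 <= C * theta ^+ n) -> False.
Proof.
move=> theta0 thnu HC; pose T := (theta + 2 * nu) / 2.
have T1 : theta < T by rewrite /T; lra.
have T2 : T < 2 * nu by rewrite /T; lra.
have T0 : 0 < T by exact: lt_trans T1.
have z0 : 0 < T^-1 by rewrite invr_gt0.
have zt : T^-1 * theta < 1 by rewrite mulrC ltr_pdivrMr // mul1r.
have [g [wg g0 g1 gS]] := green_function theta0 z0 zt HC.
have gp := g_pos z0 wg g0 g1 gS.
have rec k : g k.+3 + D * g k.+1 <= T * g k.+2.
  by rewrite [g k.+2]gS mulrDr mulVKf ?gt_eqF // lerDr mulr_ge0 // ltW.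
pose r k := g k.+2 / g k.+1; have r0 k : 0 < r k by rewrite divr_gt0.
have rS k : r k.+1 <= r k - (2 * nu - T).
  have := rec k; have g2 := gp k.+1; have g1' := gp k.
  have -> : g k.+3 = r k.+1 * g k.+2 by rewrite mulfVK // gt_eqF.
  have gE : g k.+2 = r k * g k.+1 by rewrite mulfVK // gt_eqF.
  rewrite gE -nuD => H.
  have : 0 <= (r k - nu) ^+ 2 by exact: sqr_ge0.
  have H2 : (r k.+1 * r k + nu ^+ 2) * g k.+1 <= (T * r k) * g k.+1 by lra.
  rewrite ler_pM2r // in H2.
  move=> sq; rewrite -(ler_pM2r (r0 k)); lra.
have rk k : r k <= r 0 - k%:R * (2 * nu - T).
  elim: k => [|k IHk]; first by rewrite mul0r subr0.
  by apply: le_trans (rS k) _; rewrite -natr1; lra.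
have dT : 0 < 2 * nu - T by rewrite subr_gt0.
have := archi_boundP (ltW (divr_gt0 (r0 0%N) dT)); set m := Num.bound _.
rewrite ltr_pdivrMr // => Hm; have := rk m; have := r0 m; lra.
Qed.

(** For [T = rho + nu ^ 2 / rho] the same inequality factors with roots [rho] and
[s = nu ^ 2 / rho < rho]; the differences [g k.+2 - s * g k.+1] then grow at rate
at most [rho], and so does [g]. *)
Lemma spherical_growth :
  (forall theta, 2 * nu < theta -> exp_bounded (w^~ 0%N) theta) ->
  forall rho, nu < rho -> exp_bounded (w 0) rho.
Proof.
move=> Hth rho nurho; have rho0 : 0 < rho by exact: lt_trans nurho.
pose T := rho + D / rho.
have T1 : 2 * nu < T.
  rewrite /T -(ltr_pM2r rho0) (mulrDl rho) mulfVK ?gt_eqF // -nuD.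
  have : 0 < (rho - nu) ^+ 2 by rewrite exprn_gt0 // subr_gt0.
  lra.
have T0 : 0 < T by apply: lt_trans T1; rewrite mulr_gt0.
pose theta := (2 * nu + T) / 2.
have t1 : 2 * nu < theta by rewrite /theta; lra.
have t2 : theta < T by rewrite /theta; lra.
have theta0 : 0 < theta by apply: lt_trans t1; rewrite mulr_gt0.
have z0 : 0 < T^-1 by rewrite invr_gt0.
have zt : T^-1 * theta < 1 by rewrite mulrC ltr_pdivrMr // mul1r.
have [C HC] := Hth _ t1.
have [g [wg g0 g1 gS]] := green_function theta0 z0 zt HC.
have rec k : g k.+3 + D * g k.+1 <= T * g k.+2.
  by rewrite [g k.+2]gS mulrDr mulVKf ?gt_eqF // lerDr mulr_ge0 // ltW.
pose s := D / rho.
have s_rho : s < rho.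
  rewrite ltr_pdivrMr // -nuD -expr2 ltr_pXn2r // nnegrE ltW //.
have sE : s * rho = D by rewrite mulfVK // gt_eqF.
have Dk k : g k.+2 - s * g k.+1 <= `|g 2 - s * g 1| * rho ^+ k.
  elim: k => [|k IHk]; first by rewrite expr0 mulr1 ler_norm.
  apply: le_trans (_ : rho * (g k.+2 - s * g k.+1) <= _); last first.
    by rewrite exprS mulrCA ler_wpM2l // ltW.
  by have := rec k; rewrite /T -/s -sE; lra.
pose B := `|g 2 - s * g 1| / (rho - s).
have BE : B * (rho - s) = `|g 2 - s * g 1| by rewrite mulfVK // gt_eqF // subr_gt0.
have B0 : 0 <= B by rewrite divr_ge0 // subr_ge0 ltW.
have gge0 k : 0 <= g k by exact: le_trans (wg k).
have s0 : 0 <= s by rewrite divr_ge0 // ltW.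
have gk k : g k.+1 <= (g 1 + B) * rho ^+ k.
  elim: k => [|k IHk]; first by rewrite expr0 mulr1 lerDl.
  have := Dk k; rewrite -BE.
  have : s * g k.+1 <= s * ((g 1 + B) * rho ^+ k) by exact: ler_wpM2l.
  have P0 : 0 <= rho ^+ k by rewrite exprn_ge0 // ltW.
  have : 0 <= g 1 * rho ^+ k * (rho - s) by rewrite !mulr_ge0 // subr_ge0 ltW.
  rewrite exprS; set P := rho ^+ k; lra.
exists (1 + (g 1 + B) / rho) => -[|k].
  by rewrite w_00 expr0 mulr1 lerDl divr_ge0 ?addr_ge0 // ltW.
apply: le_trans (wg _) _; apply: le_trans (gk k) _.
rewrite [leRHS]mulrDl mul1r exprS -[_ / _ * _]mulrA mulKf ?gt_eqF // lerDr.
by rewrite -exprS exprn_ge0 // ltW.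
Qed.

End Spherical.

(** * The cogrowth formula *)

Section Ramanujan.
Variables (R : realType) (G : multigraph).
Hypothesis lfG : locally_finite G.
Variables (o : vertex G) (D : nat).
Hypothesis D_gt0 : (0 < D)%N.
Hypothesis regG : regular G D.+1.

Let nu : R := Num.sqrt D%:R.

Let nu_ge1 : 1 <= nu. Proof. by rewrite -[leLHS]sqrtr1 ler_wsqrtr // ler1n. Qed.
Let nu_gt0 : 0 < nu. Proof. exact: lt_le_trans nu_ge1. Qed.
Let nuD : nu ^+ 2 = D%:R. Proof. by rewrite sqr_sqrtr. Qed.
Let d_gt0 : 0 < D.+1%:R :> R. Proof. by rewrite ltr0n. Qed.

Let w n k : R := (walk_nb o n k o)%:R.

Let w_ge0 n k : 0 <= w n k. Proof. exact: ler0n. Qed.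
Let w_00 : w 0 0 = 1. Proof. by rewrite /w /= eqxx. Qed.
Let w_0S k : w 0 k.+1 = (num_nb k.+1 o)%:R.
Proof. by rewrite /w -[walk_nb _ 0 _ _]/(nb_paths o k.+1 o) nb_pathsS. Qed.
Let w_S0 n : w n.+1 0 = w n 1. Proof. by rewrite /w walk_nb_S0. Qed.
Let w_S1 n : w n.+1 1 = w n 2 + (D%:R + 1) * w n 0.
Proof. by rewrite /w (walk_nb_S1 lfG o regG) natrD natrM natr1. Qed.
Let w_SS n k : w n.+1 k.+2 = w n k.+3 + D%:R * w n k.+1.
Proof. by rewrite /w (walk_nb_SS lfG o regG) natrD natrM. Qed.

Let transition_ge0 n : 0 <= transition R n o o.
Proof.
have := transition_walk lfG o regG R n o => E.
by rewrite -(pmulr_lge0 _ (exprn_gt0 n d_gt0)) E.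
Qed.

Let transition_bounded mu : 0 < mu -> exp_bounded (fun n => transition R n o o) mu <->
  exp_bounded (w^~ 0%N) (mu * D.+1%:R).
Proof.
move=> mu0; split=> -[C HC]; exists C => n; have := HC n.
  rewrite /w -(transition_walk lfG o regG) exprMn mulrA.
  by rewrite ler_pM2r // exprn_gt0.
by rewrite /w -(transition_walk lfG o regG) exprMn mulrA ler_pM2r // exprn_gt0.
Qed.

Lemma ramanujanP : (rate_le o nu -> ramanujan R D.+1 o) /\
  (ramanujan R D.+1 o -> forall rho, nu < rho -> rate_le o rho).
Proof.
have dE : D.+1%:R - 1 = D%:R :> R by rewrite -natr1 addrK.
have r0 : 0 < 2 * nu / D.+1%:R by rewrite divr_gt0 // mulr_gt0.
have rateP rho : 0 < rho -> rate_le o rho <-> exp_bounded (w 0) rho.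
  move=> rho0; split=> -[C HC]; exists (1 + C).
    have C0 : 0 <= C by have := HC 0%N; rewrite expr0 mulr1; apply: le_trans; rewrite ler0n.
    case=> [|k]; first by rewrite w_00 expr0 mulr1 lerDl.
    by rewrite w_0S (le_trans (HC _)) // ler_wpM2r ?exprn_ge0 ?(ltW rho0) // lerDr.
  have C0 : 0 <= C by have := HC 0%N; rewrite w_00 expr0 mulr1; apply: le_trans.
  case=> [|k]; first by rewrite num_nb0 mulr_ge0 ?exprn_ge0 ?addr_ge0 // ltW.
  by rewrite -w_0S (le_trans (HC _)) // ler_wpM2r ?exprn_ge0 ?(ltW rho0) // lerDr.
have ramE : ramanujan R D.+1 o = (spectral_radius R o = (2 * nu / D.+1%:R)%:E).
  by rewrite /ramanujan dE.
have mulK rho : rho / D.+1%:R * D.+1%:R = rho :> R by rewrite mulfVK // gt_eqF.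
have upper : (spectral_radius R o <= (2 * nu / D.+1%:R)%:E)%E <->
    forall theta, 2 * nu < theta -> exp_bounded (w^~ 0%N) theta.
  rewrite /spectral_radius limn_esup_root_leP ?(ltW r0) //; split=> H theta Ht.
    have t0 : 0 < theta by apply: lt_trans Ht; rewrite mulr_gt0.
    have := H (theta / D.+1%:R); rewrite ltr_pM2r ?invr_gt0 // => /(_ Ht).
    by rewrite transition_bounded ?divr_gt0 // mulK.
  have t0 : 0 < theta by exact: lt_trans Ht.
  by apply/transition_bounded => //; apply: H; rewrite -ltr_pdivrMr.
rewrite ramE; split=> [Hr|Rm rho nurho]; last first.
  have rho0 : 0 < rho by exact: lt_trans nurho.
  apply/rateP => //; apply: (spherical_growth nu_ge1 nuD w_ge0 w_00 w_S0 w_S1 w_SS) nurho.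
  by apply/upper; rewrite Rm.
apply/eqP; rewrite eq_le; apply/andP; split.
  apply/upper => theta Ht; have /(rateP _ nu_gt0)[C HC] := Hr.
  have C0 : 0 <= C by have := HC 0%N; rewrite w_00 expr0 mulr1; apply: le_trans.
  have nu2 : 0 < 2 * nu by rewrite mulr_gt0.
  apply: (@exp_bounded_le _ _ (2 * nu)) => //; first exact: ltW.
  exists (C + 1); exact: (spherical_upper nu_ge1 nuD w_00 w_S0 w_S1 w_SS C0 HC).
rewrite leNgt; apply/negP => low.
have [mu [mu0 mu1 Hmu]] : exists mu, [/\ 0 < mu, mu < 2 * nu / D.+1%:R &
    (spectral_radius R o < mu%:E)%E].
  move: (2 * nu / D.+1%:R) r0 low => r r0.
  case: (spectral_radius R o) => [s|//|_]; last first.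
    by exists (r / 2); rewrite ltNyr; split=> //; lra.
  rewrite lte_fin => sr; exists ((Num.max s 0 + r) / 2).
  have : Num.max s 0 < r by rewrite gt_max sr.
  have : 0 <= Num.max s 0 by rewrite le_max lexx orbT.
  have : s <= Num.max s 0 by rewrite le_max lexx.
  by rewrite lte_fin; split; lra.
have /(transition_bounded mu0)[C HC] := limn_esup_root_lt transition_ge0 mu0 Hmu.
rewrite ltr_pdivlMr // in mu1.
exact: (spherical_lower nu_ge1 nuD w_ge0 w_00 w_S0 w_S1 w_SS (mulr_gt0 mu0 d_gt0) mu1 HC).
Qed.

End Ramanujan.

(** * Structure of simple cycles *)

Section SimpleCycleStructure.
Variable G : multigraph.
Implicit Types (x y : vertex G) (a b c e f g z : edge G) (p q w : seq (edge G)).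

Lemma on_simple_cycle1 x : on_simple_cycle x 1 ->
  exists c, etail c = x /\ erev c = c.
Proof.
move=> [y [[|c [|d p]] [/andP[]]]] //; rewrite nb_cycleE => /and3P[_ /eqP ty /eqP hy] _ _ /=.
rewrite inE => /eqP ->; exists c; split=> //.
by have [_ ->] := erev_loop c; rewrite // ty -hy.
Qed.

(** If the last edge were the reverse of the first, its tail would be that of the
second edge. *)
Lemma simple_cycle_closed y p : simple_cycle y p -> (1 < size p)%N -> cycle step p.
Proof.
move=> /andP[]; rewrite nb_cycleE; case: p => [|e [|f q]] //.
move=> /and3P[ep /eqP te /eqP hl] ut _; rewrite /cycle rcons_path ep /=.
apply: stepI; first by rewrite hl te.
move=> E; have tl : etail (last f q) = etail f.
  move: ep => /= /andP[/andP[/eqP <- _] _].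
  by rewrite -ehead_erev; move: E => /= <-.
case: q ep ut E tl {hl} => [|g q] ep ut E tl.
  by move: ep E => /=; rewrite andbT => /andP[_ /eqP nf] E; apply: nf; rewrite E erevK.
move: ut => /= /and3P[_ + _]; rewrite -tl /= => /negP; apply.
by rewrite -map_cons map_f // mem_last.
Qed.

Lemma on_simple_cycleS x L : on_simple_cycle x L -> (1 < L)%N -> exists a q,
  [/\ etail a = x, (size q).+1 = L, path step a q, step (last a q) a &
    forall e, e \in a :: q -> erev e <> e].
Proof.
move=> [y [p [sp <- xp]]] L1; have cp := simple_cycle_closed sp L1.
have /andP[_ ut] := sp.
have [i s rE] := rot_to xp.
have : map (@etail G) (rot i p) = x :: s by rewrite map_rot.
have sr := size_rot i p; have cr : cycle step (rot i p) by rewrite rot_cycle.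
have ur : uniq (map (@etail G) (rot i p)) by rewrite map_rot rot_uniq.
move: (rot i p) sr cr ur => -[|a q] //= sq; rewrite rcons_path => /andP[aq qa] /andP[aNq uq] [ta _].
exists a, q; split=> // e eq Ee.
have : cycle step (a :: q) by rewrite /= rcons_path aq.
have : uniq (map (@etail G) (a :: q)) by rewrite /= aNq.
have [j r rjE] := rot_to eq; rewrite -(rot_cycle j) -(rot_uniq j) -map_rot rjE.
have : size (rot j (a :: q)) = size p by rewrite size_rot.
rewrite rjE; case: r {rjE} => [|f r] sr; first by rewrite -sr in L1.
move=> /= /andP[+ _] /andP[/andP[/eqP hf _] _].
by have [/(_ Ee) -> _] := erev_loop e; rewrite hf inE eqxx.
Qed.

Lemma nbwalks_num_fnb (lfG : locally_finite G) a n : (0 < n)%N ->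
  (nbwalks a a n <= num_fnb n (etail a))%N.
Proof.
move=> n0; apply: (@leq_cnt_inj _ _ (belast a)).
- by apply: sub_finite_set (finite_nbcycle lfG (etail a) n) => p [/andP[]].
- move=> w /(nbwalk_closed n0)[q [-> -> aq qa]]; rewrite belast_rcons.
  have N : nbcycle (etail a) (size q).+1 (a :: q).
    by apply/nbcycle_consP; split=> //; move: qa => /andP[/eqP].
  split; last by case: N.
  rewrite /fully_nb_cycle (proj1 N) /=; apply/orP; right.
  by move: qa => /andP[_]; apply: contra => /eqP ->; rewrite erevK.
- move=> v w [sv _ lv] [sw _ lw] vw.
  by have [] : a :: v = a :: w by rewrite !lastI vw lv lw.
Qed.

Lemma recurrent_degree (lfG : locally_finite G) a : recurrent a -> (1 < degree (etail a))%N.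
Proof.
move=> [q [aq /andP[/eqP hq aN]]].
have := @leq_size_cnt _ (out_edges (etail a)) [:: a; erev (last a q)] (lfG _).
rewrite /= inE aN => /(_ isT); apply => e; rewrite !inE => /orP[] /eqP -> //.
by rewrite /out_edges /= etail_erev hq.
Qed.

End SimpleCycleStructure.

(** * The cogrowth of a graph *)

Section Cogrowth.
Variables (R : realType) (G : multigraph) (o : vertex G).
Hypothesis lfG : locally_finite G.
Hypothesis connG : connected_graph G.
Hypothesis cogr_ge1 : (1 <= cogr R o)%E.
Implicit Types (x : vertex G) (mu nu lam : R).

Let nb_ge0 x n : 0 <= (num_nb n x)%:R :> R. Proof. exact: ler0n. Qed.

Lemma cogr_leP lam : 0 <= lam ->
  (cogr R o <= lam%:E)%E <-> (forall mu, lam < mu -> rate_le o mu).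
Proof. exact: (limn_esup_root_leP (nb_ge0 o)). Qed.

Lemma lt_cogr_rate x nu : 0 < nu -> (nu%:E < cogr R o)%E -> ~ rate_le x nu.
Proof.
move=> nu0 nuc /(rate_connected lfG connG o nu0) Ho.
have := limn_esup_root_le (nb_ge0 o) nu0 Ho.
by rewrite leNgt nuc.
Qed.

Lemma nb_lengths_infinite : forall N, exists2 n, (N <= n)%N & (0 < num_nb n o)%N.
Proof.
move=> N; apply: contrapT => H.
have : rate_le o (2^-1 : R).
  apply: (@exp_bounded_eventually _ _ _ N) => // n Nn.
  have -> : num_nb n o = 0%N.
    by apply/eqP; rewrite -leqn0 leqNgt; apply/negP => n0; apply: H; exists n.
  by rewrite exprn_ge0.
apply: lt_cogr_rate => //; apply: lt_le_trans cogr_ge1.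
by rewrite lte_fin invf_lt1 ?ltr1n.
Qed.

Lemma cogr_recurrent : exists a : edge G, recurrent a.
Proof.
have [n _ n0] := nb_lengths_infinite 0.
exact: exists_recurrent n0 nb_lengths_infinite.
Qed.

Lemma cogr_lower x mu : 1 <= mu -> (mu%:E < cogr R o)%E ->
  \forall n \near \oo, (0 < num_nb n x)%N -> mu ^+ n <= (num_nb n x)%:R.
Proof.
move=> mu1 muc.
have [nu munu nuc] : exists2 nu, mu < nu & (nu%:E < cogr R o)%E.
  case: (cogr R o) muc => [l|_|//]; last by exists (mu + 1); rewrite ?ltry ?ltrDl.
  by rewrite lte_fin => ml; exists ((mu + l) / 2); rewrite ?lte_fin; lra.
have nu0 : 0 < nu by apply: lt_trans munu; apply: lt_le_trans mu1.
have [[s ns]|no] := EM (exists s, 0 < num_nb s x)%N.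
  by apply: (@num_nb_eventually_ge _ _ lfG nu _ s) => // y; exact: lt_cogr_rate.
by exists 0%N => // n _ n0; exfalso; apply: no; exists n.
Qed.

Lemma cogr_cvg x : exists l : \bar R,
  (((num_nb n x)%:R : R) `^ n%:R^-1)%:E @[n --> within (nb_lengths x) \oo] --> l.
Proof.
exists (cogr R o).
have Sgt n : nb_lengths x n -> (0 < num_nb n x)%N by move=> /eqP; rewrite lt0n.
have lower mu : 1 <= mu -> (mu%:E < cogr R o)%E ->
    \forall n \near within (nb_lengths x) \oo, mu <= (num_nb n x)%:R `^ n%:R^-1.
  move=> mu1 /(cogr_lower x mu1)[N _ HN]; exists N.+1 => // n /= Nn /Sgt n0.
  rewrite powR_root_ge //; [|exact: lt_le_trans mu1|exact: leq_ltn_trans Nn].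
  by apply: HN => //=; exact: ltnW.
case E : (cogr R o) cogr_ge1 => [lam||] // lam1.
  rewrite lee_fin in lam1.
  have lam0 : 0 < lam by exact: lt_le_trans lam1.
  apply: cvg_EFin; first exact: nearW.
  apply/cvgrPdist_le => e e0.
  have [C HC] : rate_le x (lam + e / 2).
    apply: (rate_connected lfG connG (x := o)); first by rewrite addr_gt0 // divr_gt0.
    by have [H _] := cogr_leP (ltW lam0); apply: H; rewrite ?E // ltrDl divr_gt0.
  have [N HN] := geometric_eventually C (mu := lam + e / 2) (nu := lam + e) ltac:(lra) ltac:(lra).
  have low : \forall n \near within (nb_lengths x) \oo,
      lam - e <= (num_nb n x)%:R `^ n%:R^-1.
    have [mlam|mlam] := ltP (Num.max 1 (lam - e)) lam.
      have := lower (Num.max 1 (lam - e)); rewrite le_max lexx E lte_fin => /(_ isT mlam).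
      by apply: filterS => n; apply: le_trans; rewrite le_max lexx orbT.
    exists 1%N => // n /= n1 /Sgt n0; apply: le_trans (_ : 1 <= _).
      by move: mlam; rewrite le_max; lra.
    by rewrite powR_root_ge // expr1n ler1n.
  have up : \forall n \near within (nb_lengths x) \oo,
      (num_nb n x)%:R `^ n%:R^-1 <= lam + e.
    exists N.+1 => // n /= Nn _; rewrite powR_root_le //; [|by rewrite addr_gt0|].
      by apply: le_trans (HC n) (HN _ _); exact: ltnW.
    exact: leq_ltn_trans Nn.
  apply: filterS2 low up => n /= l1 l2; rewrite ler_norml; lra.
apply/cvgeyPge => A.
have := lower (Num.max 1 A); rewrite le_max lexx E ltry => /(_ isT isT).
by apply: filterS => n; rewrite lee_fin; apply: le_trans; rewrite le_max lexx orbT.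
Qed.

End Cogrowth.

Section FiniteCogrowth.
Variables (R : realType) (G : multigraph) (o : vertex G).
Hypothesis lfG : locally_finite G.
Hypothesis connG : connected_graph G.
Hypothesis cogr_ge1 : (1 <= cogr R o)%E.
Variable lam : R.
Hypothesis cogrE : cogr R o = lam%:E.

Let lam_ge1 : 1 <= lam. Proof. by move: cogr_ge1; rewrite cogrE lee_fin. Qed.
Let lam_gt0 : 0 < lam. Proof. exact: lt_le_trans lam_ge1. Qed.

Lemma rate_gt_cogr (x : vertex G) mu : lam < mu -> rate_le x mu.
Proof.
move=> lmu; apply: (rate_connected lfG connG (x := o)); first exact: lt_trans lmu.
by have [H _] := cogr_leP o (ltW lam_gt0); apply: H; rewrite // cogrE.
Qed.

Lemma rate_cogr (x : vertex G) : rate_le x lam.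
Proof.
have [a ra] := cogr_recurrent lfG connG cogr_ge1.
apply: (rate_connected lfG connG (x := etail a)) => //.
apply: (rate_le_of_nbwalks lfG (C := 1) ra) => // n; rewrite mul1r.
by apply: nbwalks_le_rate => //; exact: rate_gt_cogr.
Qed.

(** If [lam ^ 2 < lam + 1] then [lam < 2], so that [lam ^ 2 <= 2 L] for every simple
cycle which is not a loop. *)
Lemma num_nb_le_simple_cycle (x : vertex G) L : on_simple_cycle x L -> exists c : R,
  c <= 2 + 2 * L%:R * lam `^ (L%:R - 2) /\
  forall n, (num_nb n x)%:R <= c * lam ^+ n.
Proof.
move=> xL.
have L0 : (0 < L)%N by move: xL => [y [[|e p] [/andP[/andP[]]]]] // _ _ _ <-.
have V0 : 0 < lam^-1 by rewrite invr_gt0.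
have invL : 2 + 2 / lam <= 2 + 2 * L%:R * lam `^ (L%:R - 2).
  rewrite lerD2l -mulrA ler_pM2l //.
  apply: le_trans (_ : 1 * lam `^ (L%:R - 2) <= _); last first.
    by rewrite ler_wpM2r ?powR_ge0 // ler1n.
  rewrite mul1r -(powR_inv1 (ltW lam_gt0)); apply: ler_powR => //.
  have L1 : 1 <= L%:R :> R by rewrite ler1n.
  lra.
have [golden|small] := leP (lam + 1) (lam ^+ 2).
  exists (2 + 2 / lam); split=> // n.
  by apply: num_nb_le_golden => // y; exact: rate_gt_cogr.
have [L1|L2] := leqP L 1.
  have LE : L = 1%N by apply/eqP; rewrite eqn_leq L1.
  rewrite {}LE in xL invL *; have [c [tc cc]] := on_simple_cycle1 xL.
  exists (2 + 2 / lam); split=> // n; rewrite -tc.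
  by apply: num_nb_le_loop => //; [move=> y; exact: rate_gt_cogr|exact: ltW].
have [a [q [ta sq aq qa nl]]] := on_simple_cycleS xL L2.
exists (2 + 2 * L%:R * lam ^+ (L - 2)); split=> [|n].
  by rewrite -powR_mulrn ?(ltW lam_gt0) // natrB.
have -> : (L - 2 = (size q).-1)%N by lia.
rewrite -ta -sq; apply: num_nb_le_cycle => //; first by move=> y; exact: rate_gt_cogr.
  by lia.
have lam2 : lam < 2 by nra.
have : 2 <= (size q).+1%:R :> R by rewrite ler_nat sq.
nra.
Qed.

End FiniteCogrowth.

Lemma expe_pinfty (R : realType) n : (0 < n)%N -> ((+oo : \bar R) ^+ n)%E = +oo%E.
Proof. by elim: n => // -[_ _|n IHn _]; rewrite ?expe1 // expeS IHn // mulyy. Qed.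

Theorem proposition1p5 (R : realType) (G : multigraph) (o : vertex G)
  (G_infinite : infinite_set [set: vertex G])
  (G_connected : connected_graph G)
  (G_locally_finite : locally_finite G)
  (cogr_ge1 : (1 <= cogr R o)%E) :
  [/\ forall x : vertex G,
        (exists l : \bar R,
           (((num_nb n x)%:R : R) `^ n%:R^-1)%:E @[n --> within (nb_lengths x) \oo] --> l) /\
        (exists c : R, forall n : nat, (1 <= n)%N ->
           ((num_nb n x)%:R%:E <= c%:E * cogr R o ^+ n)%E),
      forall (x : vertex G) (L : nat), on_simple_cycle x L ->
        exists c : R,
          (c%:E <= 2%:E + (2 * L%:R)%:E * poweR (cogr R o) (L%:R - 2))%E /\
          forall n : nat, (1 <= n)%N ->
            ((num_nb n x)%:R%:E <= c%:E * cogr R o ^+ n)%E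
    & forall d : nat, regular G d ->
        (ramanujan R d o <->
         forall (x : vertex G) (n : nat), (1 <= n)%N ->
           (num_fnb n x)%:R <= 2 * ((d%:R - 1) `^ (n%:R / 2)) :> R)].
Proof.
have infinite_bound x n (c : R) : cogr R o = +oo%E -> 0 < c -> (1 <= n)%N ->
    ((num_nb n x)%:R%:E <= c%:E * cogr R o ^+ n)%E.
  by move=> -> c0 n1; rewrite expe_pinfty // gt0_muley ?lte_fin // leey.
have finite_bound x n (c lam : R) : cogr R o = lam%:E ->
    (num_nb n x)%:R <= c * lam ^+ n -> ((num_nb n x)%:R%:E <= c%:E * cogr R o ^+ n)%E.
  by move=> -> H; rewrite -EFin_expe -EFinM lee_fin.
split.
- move=> x; split; first exact: (cogr_cvg G_locally_finite G_connected cogr_ge1).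
  case E : (cogr R o) (cogr_ge1) => [lam||] // _.
    have [c Hc] := rate_cogr G_locally_finite G_connected cogr_ge1 E x.
    by exists c => n _; rewrite -E; exact: finite_bound (Hc n).
  by exists 1 => n n1; rewrite -E; exact: infinite_bound.
- move=> x L xL; case E : (cogr R o) (cogr_ge1) => [lam||] // _.
    have [c [cL Hc]] := num_nb_le_simple_cycle G_locally_finite G_connected cogr_ge1 E xL.
    exists c; split=> [|n _]; first by rewrite poweR_EFin -EFinM -EFinD lee_fin.
    by rewrite -E; exact: finite_bound (Hc n).
  exists 2; split=> [|n n1]; last by rewrite -E; exact: infinite_bound.
  by rewrite leeDl // mule_ge0 ?poweR_ge0 // lee_fin mulr_ge0.
- move=> d reg_d.
  have [a ra] := cogr_recurrent G_locally_finite G_connected cogr_ge1.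
  have := recurrent_degree G_locally_finite ra; rewrite reg_d => d1.
  have [D DE] : exists D, d = D.+1 by exists d.-1; lia.
  have D0 : (0 < D)%N by lia.
  rewrite {}DE in reg_d *.
  have -> : D.+1%:R - 1 = D%:R :> R by rewrite -natr1 addrK.
  pose nu : R := Num.sqrt D%:R.
  have nu1 : 1 <= nu by rewrite -[leLHS]sqrtr1 ler_wsqrtr // ler1n.
  have nu0 : 0 < nu by exact: lt_le_trans nu1.
  have powE n : (D%:R : R) `^ (n%:R / 2) = nu ^+ n.
    by rewrite mulrC powRrM powR12_sqrt // powR_mulrn // ltW.
  have [ram_of_rate rate_of_ram] := ramanujanP R G_locally_finite o D0 reg_d.
  split=> [ram x n n1|fnb].
    have : (cogr R o <= nu%:E)%E.
      by apply/cogr_leP; [exact: ltW|exact: rate_of_ram].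
    case E : (cogr R o) (cogr_ge1) => [lam||] // lam1; rewrite lee_fin => lam_nu.
    rewrite lee_fin in lam1; rewrite powE.
    apply: le_trans (num_fnb_le G_locally_finite lam1 _ n1) _.
      by move=> mu lmu; apply: (rate_gt_cogr G_locally_finite G_connected cogr_ge1 E).
    rewrite ler_pM2l // lerXn2r // nnegrE; [exact: le_trans lam1|exact: ltW].
  apply: ram_of_rate; apply: (rate_connected G_locally_finite G_connected (x := etail a)) => //.
  apply: (rate_le_of_nbwalks G_locally_finite (C := 2) ra) => // -[|n].
    by rewrite nbwalks0 // expr0 mulr1 ler1n.
  apply: le_trans (_ : (num_fnb n.+1 (etail a))%:R <= _).
    by rewrite ler_nat; exact: nbwalks_num_fnb.
  by rewrite -powE; exact: fnb.
Qed.
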